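(* Let $A \in \mathbb{C}^{N\times N}$ be a positive semidefinite matrix, let $\mu > 0$ and $\delta \in (0,1)$, and let $\widehat{A}$ denote the approximation produced by running the randomly pivoted Cholesky algorithm on $A$ for $k$ steps, where $k$ is a nonnegative integer with $k \ge 30\, d_{\rm eff}(\mu)\log(16\, d_{\rm eff}(\mu)/\delta)$. Then, with probability at least $1-\delta$, $$\operatorname{cond}\Bigl((\widehat{A}+\mu I)^{-1/2}(A+\mu I)(\widehat{A}+\mu I)^{-1/2}\Bigr) \le 2.$$
   Context: A matrix $A\in\mathbb{C}^{N\times N}$ is positive semidefinite (psd) if $A = A^*$ and all its eigenvalues are nonnegative. For a Hermitian positive definite matrix $M$, $\operatorname{cond}(M) = \lambda_{\max}(M)/\lambda_{\min}(M)$. The $\mu$-effective dimension of $A$ is $$d_{\rm eff}(\mu) = \operatorname{tr}\bigl[A(A+\mu I)^{-1}\bigr] = \sum_{i=1}^N \frac{\lambda_i(A)}{\lambda_i(A)+\mu},$$ where $\lambda_i(A)$ are the eigenvalues of $A$. $\log$ is the natural logarithm, with $0\log 0 = 0$. Randomly pivoted Cholesky algorithm on $A$: set $\widehat{A}^{(0)} = 0$. At step $i=1,2,\dots$, conditionally on the past, draw a random pivot index $s_i\in\{1,\dots,N\}$ with $$\mathbb{P}\{s_i = t\} = \frac{A(t,t) - \widehat{A}^{(i-1)}(t,t)}{\operatorname{tr}(A - \widehat{A}^{(i-1)})},$$ let $v_i = A(:,s_i) - \widehat{A}^{(i-1)}(:,s_i)$ (the $s_i$-th column of $A-\widehat{A}^{(i-1)}$),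 and set $\widehat{A}^{(i)} = \widehat{A}^{(i-1)} + v_i v_i^*/v_i(s_i)$. Convention: if $A - \widehat{A}^{(i-1)} = 0$, then $\widehat{A}^{(i)} = \widehat{A}^{(i-1)}$. The approximation produced by $k$ steps is $\widehat{A}=\widehat{A}^{(k)}$. *)

(* Defs.v *)
From mathcomp Require Import all_boot all_order all_algebra.
From mathcomp Require Import spectral complex.
From mathcomp Require Import all_classical all_reals all_analysis.

Set Implicit Arguments.
Unset Strict Implicit.
Unset Printing Implicit Defensive.

Import Order.TTheory GRing.Theory Num.Theory.
Local Open Scope classical_set_scope.
Local Open Scope complex_scope.
Local Open Scope sesquilinear_scope.
Local Open Scope ring_scope.

(* On R[i], [0 <= a] says that a is real and nonnegative. *)
Definition psdmx (R : realType) N (A : 'M[R[i]]_N) : Prop :=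
  A = A ^t* /\ forall a : R[i], eigenvalue A a -> 0 <= a.

Definition lambda_max (R : realType) N (M : 'M[R[i]]_N) : R :=
  sup [set x : R | eigenvalue M x%:C].

Definition lambda_min (R : realType) N (M : 'M[R[i]]_N) : R :=
  inf [set x : R | eigenvalue M x%:C].

Definition cond (R : realType) N (M : 'M[R[i]]_N) : R :=
  lambda_max M / lambda_min M.

(* The trace is real when A is psd and 0 < mu. *)
Definition deff (R : realType) N (A : 'M[R[i]]_N) (mu : R) : R :=
  complex.Re (\tr (A *m invmx (A + (mu%:C)%:M))).

(* M ^ (-1/2) for a Hermitian positive definite M: the function
   x |-> x ^ (-1/2) is applied to the eigenvalues of M in the unitary
   diagonalization
   M = invmx (spectralmx M) *m diag_mx (spectral_diag M) *m spectralmx M. *)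
Definition invsqrtmx (R : realType) N (M : 'M[R[i]]_N) : 'M[R[i]]_N :=
  invmx (spectralmx M)
  *m diag_mx (map_mx (fun x : R[i] => (sqrtC x)^-1) (spectral_diag M))
  *m spectralmx M.

Definition rpc_step (R : realType) N (A Ah : 'M[R[i]]_N) (s : 'I_N) :
    'M[R[i]]_N :=
  let v := col s (A - Ah) in
  if A - Ah == 0 then Ah else Ah + (v s 0)^-1 *: (v *m v ^t*).

(* The partial Cholesky approximation for the pivots h = [:: s_1; ...; s_i]. *)
Definition rpc_approx (R : realType) N (A : 'M[R[i]]_N) (h : seq 'I_N) :
    'M[R[i]]_N :=
  foldl (rpc_step A) 0 h.

(* Both the diagonal entry and the trace are real when A is psd. *)
Definition pivot_prob (R : realType) N (A Ah : 'M[R[i]]_N) (t : 'I_N) : R :=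
  complex.Re ((A - Ah) t t) / complex.Re (\tr (A - Ah)).

Definition pivots (N : nat) (T : Type) (s : nat -> T -> 'I_N) (i : nat) (w : T) :
    seq 'I_N :=
  mkseq (fun j => s j w) i.

(* [s 0, ..., s k.-1] are the random pivots of k steps (numbered from 0).  The
   conditional law of [s i] given the past is expressed by the product rule on
   every possible past h; it is unconstrained once the residual is zero, since
   the approximation no longer changes. *)
Definition rpc_pivots (R : realType) (d : measure_display)
    (T : measurableType d) (P : probability T R) N (A : 'M[R[i]]_N) (k : nat)
    (s : nat -> T -> 'I_N) : Prop :=
  forall i : nat, (i < k)%N ->
    (forall t : 'I_N, measurable [set w | s i w = t]) /\
    (forall (h : seq 'I_N) (t : 'I_N), size h = i -> A - rpc_approx A h != 0 ->
      P ([set w | pivots s i w = h] `&` [set w | s i w = t]) =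
      (P [set w | pivots s i w = h] * (pivot_prob A (rpc_approx A h) t)%:E)%E).

(* Main.v *)
Require Import Defs.
From mathcomp Require Import all_boot all_order all_algebra.
From mathcomp Require Import spectral complex.
From mathcomp Require Import all_classical all_reals all_analysis.
From mathcomp Require Import ring lra.
Set Implicit Arguments.
Unset Strict Implicit.
Unset Printing Implicit Defensive.

Import Order.TTheory GRing.Theory Num.Theory.
Local Open Scope classical_set_scope.
Local Open Scope complex_scope.
Local Open Scope sesquilinear_scope.
Local Open Scope ring_scope.

(** Let M_h be the residual of A after the pivots h, let d = deff A mu and
    L = ln (16 d / delta).  A pivot t replaces M by M - M e_t (M e_t)^* / M_tt and
    is drawn with probability M_tt / tr M, so the expectation of a function of the
    next residual is a sum weighted by the diagonal entries, divided by tr M.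

    If every eigenvalue of M_h is at most mu, then, writing Ah for A - M_h,
      Ah + mu <= A + mu <= 2 (Ah + mu)
    and the preconditioned matrix has its spectrum in [1, 2]
    ([precond_ev_bounds]).  So it is enough that the eigenvalues of M_h are at
    most mu outside an event of probability delta.  If d <= 1/2 this is true of
    A itself.  Otherwise the argument has two stages.

    First, about 4 d L steps bring the trace of the residual below 4 d mu.  By the
    formula for the determinant of a rank-one update, the mean of
    tr M * det (M' + mu) over one step is at most
    mu * tr (M (M + mu)^-1) * det (M + mu), and the middle factor is at most d
    because M <= A.  Hence the product of the first m traces times
    det (M_m + mu) has mean at most (mu d)^m det (A + mu)
    ([mean_trace_prod_det]).  On the other hand A - M_i has rank at most i, so
    tr M_i is at least the (i+1)-st largest eigenvalue of A: the large eigenvalues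
    of A in det (A + mu) are cancelled by the first traces, whatever their size.
    This is why the number of steps does not depend on tr A.  What is left is
    P (tr M_m > 4 d mu) <= exp (2 d ln (8 d) - m)  ([prob_large_trace]).

    Then, 8 d L further steps bring the eigenvalues below mu.  The potential
    is the trace of the positive part of M - mu / 2.  The next residual has the
    nonzero spectrum of a compression of M to a hyperplane, so, the positive part
    being convex, the potential drops by at least tr (M (M - mu / 2)_+) / tr M in
    mean ([excess_tr_elim_le]).  Only eigenvalues at least mu / 2 contribute, so
    while tr M <= 4 d mu the potential shrinks by the factor 1 - 1 / (8 d) at each
    step ([mean_excess]), whereas an eigenvalue above mu makes it at least mu / 2. *)

(** * Conjugate transposes and positive semidefinite forms *)

Lemma adjmxM (C : numClosedFieldType) m n p (A : 'M[C]_(m, n)) (B : 'M[C]_(n, p)) :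
  (A *m B) ^t* = B ^t* *m A ^t*.
Proof. by rewrite trmx_mul map_mxM. Qed.

Lemma adjmxD (C : numClosedFieldType) m n (A B : 'M[C]_(m, n)) :
  (A + B) ^t* = A ^t* + B ^t*.
Proof. by rewrite linearD map_mxD. Qed.

Lemma adjmxB (C : numClosedFieldType) m n (A B : 'M[C]_(m, n)) :
  (A - B) ^t* = A ^t* - B ^t*.
Proof. by rewrite linearB map_mxB. Qed.

Lemma adjmxZ (C : numClosedFieldType) m n (c : C) (A : 'M[C]_(m, n)) :
  (c *: A) ^t* = c^* *: A ^t*.
Proof. by rewrite linearZ /= map_mxZ. Qed.

Lemma adjmx_scalar (C : numClosedFieldType) n (c : C) :
  (c%:M : 'M[C]_n) ^t* = (c^*)%:M.
Proof. by rewrite tr_scalar_mx map_scalar_mx. Qed.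

(** The semidefinite order is handled through quadratic forms rather than
    eigenvalues: in this form it is visibly stable under sums and congruences. *)
Definition psdform (C : numClosedFieldType) n (M : 'M[C]_n) : Prop :=
  M ^t* = M /\ forall x : 'rV[C]_n, 0 <= (x *m M *m x ^t*) 0 0.

Lemma psdform_congr (C : numClosedFieldType) m n (T : 'M[C]_(m, n)) (M : 'M[C]_n) :
  psdform M -> psdform (T *m M *m T ^t*).
Proof.
move=> [Mh Mp]; split; first by rewrite !adjmxM trmxCK Mh mulmxA.
by move=> x; have := Mp (x *m T); rewrite adjmxM !mulmxA.
Qed.

Lemma psdformD (C : numClosedFieldType) n (M1 M2 : 'M[C]_n) :
  psdform M1 -> psdform M2 -> psdform (M1 + M2).
Proof.
move=> [h1 p1] [h2 p2]; split; first by rewrite adjmxD h1 h2.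
by move=> x; rewrite mulmxDr mulmxDl mxE addr_ge0.
Qed.

Lemma psdformZ (C : numClosedFieldType) n (c : C) (M : 'M[C]_n) :
  0 <= c -> psdform M -> psdform (c *: M).
Proof.
move=> c0 [h p]; split; first by rewrite adjmxZ h (CrealP _) // ger0_real.
by move=> x; rewrite -scalemxAr -scalemxAl mxE mulr_ge0.
Qed.

Lemma norm2_ge0 (C : numClosedFieldType) n (x : 'rV[C]_n) : 0 <= (x *m x ^t*) 0 0.
Proof. by rewrite mxE sumr_ge0 // => i _; rewrite !mxE mul_conjC_ge0. Qed.

Lemma norm2_gt0 (C : numClosedFieldType) n (x : 'rV[C]_n) :
  x != 0 -> 0 < (x *m x ^t*) 0 0.
Proof. by move=> x0; rewrite -dotmxE dnorm_gt0. Qed.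

Lemma psdform1 (C : numClosedFieldType) n : psdform (1%:M : 'M[C]_n).
Proof.
split=> [|x]; first by rewrite trmx1 map_mx1.
by rewrite mulmx1 norm2_ge0.
Qed.

Lemma psdform_gram (C : numClosedFieldType) m n (T : 'M[C]_(m, n)) :
  psdform (T *m T ^t*).
Proof. by rewrite -[X in X *m _](mulmx1 T); apply/psdform_congr/psdform1. Qed.

Lemma psdform_subrr (C : numClosedFieldType) n (A : 'M[C]_n) : psdform (A - A).
Proof.
rewrite subrr -[0](scale0r (1%:M : 'M[C]_n)).
by apply: psdformZ (psdform1 _ _).
Qed.

Lemma psdform_sub_trans (C : numClosedFieldType) n (X Y Z : 'M[C]_n) :
  psdform (X - Y) -> psdform (Y - Z) -> psdform (X - Z).
Proof.
have -> : X - Z = (X - Y) + (Y - Z) by rewrite addrA subrK.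
exact: psdformD.
Qed.

Lemma psdform_subK (C : numClosedFieldType) n (A X : 'M[C]_n) :
  psdform (A - (A - X)) -> psdform X.
Proof. by rewrite subKr. Qed.

Lemma psdform_diag_ge0 (C : numClosedFieldType) n (M : 'M[C]_n) i :
  psdform M -> 0 <= M i i.
Proof.
move=> [_ /(_ (delta_mx 0 i))].
have -> : ((delta_mx 0 i : 'rV[C]_n) *m M *m (delta_mx 0 i : 'rV[C]_n) ^t*) 0 0 = M i i => //.
by rewrite trmx_delta map_delta_mx -(rowE i M) -(colE i) !mxE.
Qed.

Lemma psdform_diag_real (C : numClosedFieldType) n (M : 'M[C]_n) t :
  psdform M -> (M t t)^* = M t t.
Proof. by move=> pM; apply/CrealP/ger0_real/psdform_diag_ge0. Qed.

Lemma psdform_tr_ge0 (C : numClosedFieldType) n (M : 'M[C]_n) :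
  psdform M -> 0 <= \tr M.
Proof. by move=> hM; apply: sumr_ge0 => i _; apply: psdform_diag_ge0. Qed.

(** * Functional calculus of a Hermitian matrix *)

(** The function f of the Hermitian matrix M. *)
Definition fmx (C : numClosedFieldType) n (M : 'M[C]_n) (f : C -> C) : 'M[C]_n :=
  (spectralmx M) ^t* *m diag_mx (map_mx f (spectral_diag M)) *m spectralmx M.

Lemma spectralmx_mulV (C : numClosedFieldType) n (M : 'M[C]_n) :
  spectralmx M *m (spectralmx M) ^t* = 1%:M.
Proof. exact/unitarymxP/spectral_unitarymx. Qed.

Lemma spectralmx_mulVl (C : numClosedFieldType) n (M : 'M[C]_n) :
  (spectralmx M) ^t* *m spectralmx M = 1%:M.
Proof. by apply: mulmx1C; apply: spectralmx_mulV. Qed.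

Lemma adj_hermsymmx (C : numClosedFieldType) n (M : 'M[C]_n) :
  M ^t* = M -> M \is hermsymmx.
Proof. by move=> Mh; apply/is_hermitianmxP; rewrite expr0 scale1r Mh. Qed.

Lemma spectral_diag_real (C : numClosedFieldType) n (M : 'M[C]_n) i :
  M ^t* = M -> spectral_diag M 0 i \is Num.real.
Proof.
by move=> /adj_hermsymmx/hermitian_spectral_diag_real/mxOverP.
Qed.

Lemma fmx_id (C : numClosedFieldType) n (M : 'M[C]_n) : M ^t* = M -> fmx M id = M.
Proof.
move=> /adj_hermsymmx Mh; rewrite /fmx [map_mx id _]map_mx_id //.
rewrite -invmx_unitary ?spectral_unitarymx //.
by rewrite -(orthomx_spectralP (hermitian_normalmx Mh)).
Qed.

Lemma fmxM (C : numClosedFieldType) n (M : 'M[C]_n) f g :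
  fmx M f *m fmx M g = fmx M (fun x => f x * g x).
Proof.
rewrite /fmx !mulmxA -(mulmxA _ (spectralmx M) _) spectralmx_mulV mulmx1.
rewrite -(mulmxA _ (diag_mx _) (diag_mx _)) mulmx_diag.
by congr (_ *m diag_mx _ *m _); apply/rowP => i; rewrite !mxE.
Qed.

Lemma fmxD (C : numClosedFieldType) n (M : 'M[C]_n) f g :
  fmx M f + fmx M g = fmx M (fun x => f x + g x).
Proof.
rewrite /fmx -mulmxDl -mulmxDr -linearD.
by congr (_ *m diag_mx _ *m _); apply/rowP => i; rewrite !mxE.
Qed.

Lemma fmx_cst (C : numClosedFieldType) n (M : 'M[C]_n) c : fmx M (fun=> c) = c%:M.
Proof.
rewrite /fmx; have -> : map_mx (fun=> c) (spectral_diag M) = const_mx c.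
  by apply/rowP => i; rewrite !mxE.
by rewrite diag_const_mx mul_mx_scalar -scalemxAl spectralmx_mulVl scalemx1.
Qed.

Lemma eq_fmx (C : numClosedFieldType) n (M : 'M[C]_n) f g :
  (forall i, f (spectral_diag M 0 i) = g (spectral_diag M 0 i)) -> fmx M f = fmx M g.
Proof.
by move=> fg; congr (_ *m diag_mx _ *m _); apply/rowP => i; rewrite !mxE fg.
Qed.

Lemma fmx_adj (C : numClosedFieldType) n (M : 'M[C]_n) f :
  (forall i, f (spectral_diag M 0 i) \is Num.real) -> (fmx M f) ^t* = fmx M f.
Proof.
move=> fr; rewrite /fmx !adjmxM trmxCK mulmxA tr_diag_mx map_diag_mx.
by congr (_ *m diag_mx _ *m _); apply/rowP => i; rewrite !mxE; apply/CrealP.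
Qed.

Lemma fmx_tr (C : numClosedFieldType) n (M : 'M[C]_n) f :
  \tr (fmx M f) = \sum_i f (spectral_diag M 0 i).
Proof.
rewrite /fmx mxtrace_mulC mulmxA spectralmx_mulV mul1mx mxtrace_diag.
by apply: eq_bigr => i _; rewrite mxE.
Qed.

Lemma fmx_det (C : numClosedFieldType) n (M : 'M[C]_n) f :
  \det (fmx M f) = \prod_i f (spectral_diag M 0 i).
Proof.
rewrite /fmx det_mulmx mulrC det_mulmx mulrA -det_mulmx spectralmx_mulV det1 mul1r.
by rewrite det_diag; apply: eq_bigr => i _; rewrite mxE.
Qed.

Lemma psdform_fmx (C : numClosedFieldType) n (M : 'M[C]_n) f :
  (forall i, 0 <= f (spectral_diag M 0 i)) -> psdform (fmx M f).
Proof.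
move=> f0.
have -> : fmx M f = fmx M (fun x => sqrtC (f x)) *m (fmx M (fun x => sqrtC (f x))) ^t*.
  rewrite fmx_adj => [|i]; last by rewrite ger0_real ?sqrtC_ge0.
  by rewrite fmxM; apply: eq_fmx => i /=; rewrite -expr2 sqrtCK.
exact: psdform_gram.
Qed.

Lemma fmx_inv (C : numClosedFieldType) n (M : 'M[C]_n) f :
  (forall i, f (spectral_diag M 0 i) != 0) ->
  fmx M f \in unitmx /\ invmx (fmx M f) = fmx M (fun x => (f x)^-1).
Proof.
move=> f0; have fK : fmx M f *m fmx M (fun x => (f x)^-1) = 1%:M.
  by rewrite fmxM -(fmx_cst M 1); apply: eq_fmx => i; rewrite divff.
have [fu _] := mulmx1_unit fK; split=> //.
by rewrite -[RHS](mulKmx fu) fK mulmx1.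
Qed.

Lemma spectral_row (C : numClosedFieldType) n (M : 'M[C]_n) i : M ^t* = M ->
  row i (spectralmx M) *m M = spectral_diag M 0 i *: row i (spectralmx M).
Proof.
move=> Mh; rewrite -[X in _ *m X](fmx_id Mh) /fmx -row_mul !mulmxA.
rewrite spectralmx_mulV mul1mx [map_mx id _]map_mx_id // row_mul.
have -> : row i (diag_mx (spectral_diag M)) = spectral_diag M 0 i *: delta_mx 0 i.
  by apply/rowP => j; rewrite !mxE eqxx eq_sym mulr_natr.
by rewrite -scalemxAl -rowE.
Qed.

Lemma spectral_row_norm (C : numClosedFieldType) n (M : 'M[C]_n) i :
  (row i (spectralmx M) *m (row i (spectralmx M)) ^t*) 0 0 = 1.
Proof.
rewrite -dotmxE; have /row_unitarymxP := spectral_unitarymx M.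
by move=> ->; rewrite eqxx.
Qed.

Lemma spectral_row_form (C : numClosedFieldType) n (M : 'M[C]_n) i : M ^t* = M ->
  (row i (spectralmx M) *m M *m (row i (spectralmx M)) ^t*) 0 0 = spectral_diag M 0 i.
Proof.
by move=> Mh; rewrite spectral_row // -scalemxAl mxE spectral_row_norm mulr1.
Qed.

Lemma spectral_diag_ge0 (C : numClosedFieldType) n (M : 'M[C]_n) i :
  psdform M -> 0 <= spectral_diag M 0 i.
Proof. by move=> [Mh Mp]; rewrite -spectral_row_form. Qed.

Lemma spectral_eigenvalue (C : numClosedFieldType) n (M : 'M[C]_n) i : M ^t* = M ->
  eigenvalue M (spectral_diag M 0 i).
Proof.
move=> Mh; apply/eigenvalueP; exists (row i (spectralmx M)); first exact: spectral_row.
apply/eqP => r0; have := spectral_row_norm M i.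
by rewrite r0 mul0mx mxE => /eqP; rewrite eq_sym oner_eq0.
Qed.

Lemma psdmx_psdform (R : realType) n (M : 'M[R[i]]_n) : psdmx M -> psdform M.
Proof.
move=> [Mh Me]; have Mh' := esym Mh.
rewrite -(fmx_id Mh'); apply: psdform_fmx => i.
exact/Me/spectral_eigenvalue.
Qed.

Lemma hermitian_tr (C : numClosedFieldType) n (M : 'M[C]_n) : M ^t* = M ->
  \tr M = \sum_i spectral_diag M 0 i.
Proof. by move=> Mh; rewrite -[in LHS](fmx_id Mh) fmx_tr. Qed.

Lemma psdform_tr0 (C : numClosedFieldType) n (M : 'M[C]_n) :
  psdform M -> \tr M = 0 -> M = 0.
Proof.
move=> pM; have [Mh _] := pM; rewrite hermitian_tr // => /psumr_eq0P H.
have {}H i : spectral_diag M 0 i = 0.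
  by apply: H => // j _; apply: spectral_diag_ge0.
rewrite -(fmx_id Mh) (eq_fmx (g := fun=> 0)) // fmx_cst.
by apply/matrixP => i j; rewrite !mxE mul0rn.
Qed.

Lemma fmx_sqrt_adj (C : numClosedFieldType) n (M : 'M[C]_n) :
  psdform M -> (fmx M sqrtC) ^t* = fmx M sqrtC.
Proof.
by move=> pM; apply: fmx_adj => i; rewrite ger0_real ?sqrtC_ge0 ?spectral_diag_ge0.
Qed.

Lemma fmx_sqrt_sqr (C : numClosedFieldType) n (M : 'M[C]_n) :
  M ^t* = M -> fmx M sqrtC *m fmx M sqrtC = M.
Proof.
move=> Mh; rewrite fmxM -[RHS](fmx_id Mh); apply: eq_fmx => i.
by rewrite -expr2 sqrtCK.
Qed.

(** With Y = S S for a Hermitian S, the trace is that of the congruence S X S. *)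
Lemma psdform_trM_ge0 (C : numClosedFieldType) n (X Y : 'M[C]_n) :
  psdform X -> psdform Y -> 0 <= \tr (X *m Y).
Proof.
move=> pX [Yh Yp].
have -> : Y = fmx Y sqrtC *m (fmx Y sqrtC) ^t*.
  rewrite fmx_adj => [|i]; last by rewrite ger0_real ?sqrtC_ge0 ?spectral_diag_ge0.
  rewrite fmxM -[LHS](fmx_id Yh); apply: eq_fmx => i.
  by rewrite -expr2 sqrtCK.
rewrite mulmxA mxtrace_mulC mulmxA.
set Z := fmx Y sqrtC; have := psdform_congr (Z ^t*) pX; rewrite trmxCK.
exact: psdform_tr_ge0.
Qed.

(** An upper bound on the spectrum is an upper bound in the semidefinite order. *)
Lemma spectral_diag_le_psdform (C : numClosedFieldType) n (M : 'M[C]_n) c : M ^t* = M ->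
  (forall i, spectral_diag M 0 i <= c) -> psdform (c%:M - M).
Proof.
move=> Mh le; have -> : c%:M - M = fmx M (fun x => c + (-1) * x).
  rewrite -fmxD -(fmxM M (fun=> -1) id) !fmx_cst fmx_id //.
  by rewrite mul_scalar_mx scaleN1r.
by apply: psdform_fmx => i; rewrite mulN1r subr_ge0.
Qed.

Lemma psdform_le_tr (C : numClosedFieldType) n (M : 'M[C]_n) :
  psdform M -> psdform ((\tr M)%:M - M).
Proof.
move=> pM; have [Mh _] := pM; apply: spectral_diag_le_psdform => // i.
rewrite hermitian_tr // (bigD1 i) //= lerDl sumr_ge0 // => j _.
exact: spectral_diag_ge0.
Qed.

(** * One elimination step *)

(** The Schur complement step.  It is the identity when M t t = 0, as the inverse
    of 0 is 0. *)
Definition elim (C : numClosedFieldType) n (M : 'M[C]_n) (t : 'I_n) : 'M[C]_n :=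
  M - (M t t)^-1 *: (col t M *m (col t M) ^t*).

Lemma hermitian_row (C : numClosedFieldType) n (M : 'M[C]_n) t :
  M ^t* = M -> row t M = (col t M) ^t*.
Proof.
by move=> Mh; apply/rowP => j; rewrite -[in LHS]Mh !mxE.
Qed.

Lemma psdform_subelim (C : numClosedFieldType) n (M : 'M[C]_n) t :
  psdform M -> psdform (M - elim M t).
Proof.
move=> pM; rewrite /elim opprB addrCA subrr addr0.
by apply/psdformZ/psdform_gram; rewrite invr_ge0 psdform_diag_ge0.
Qed.

(** The step is a congruence T M T^*, where T = 1 - M_tt^-1 M e_t e_t^* is the
    oblique projection that kills the pivot column. *)
Lemma psdform_elim (C : numClosedFieldType) n (M : 'M[C]_n) t :
  psdform M -> psdform (elim M t).
Proof.
move=> pM; have [Mh _] := pM.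
have [Mt0|Mt0] := eqVneq (M t t) 0.
  by rewrite /elim Mt0 invr0 scale0r subr0.
pose T : 'M[C]_n := 1%:M - (M t t)^-1 *: (col t M *m (delta_mx 0 t : 'rV[C]_n)).
have TM : T *m M = elim M t.
  rewrite /T mulmxBl mul1mx -scalemxAl -mulmxA -(rowE t M) hermitian_row //.
have <- : T *m M *m T ^t* = elim M t; last exact: psdform_congr.
rewrite TM /T adjmxB adjmxZ adjmxM adjmx_scalar conjC1 mulmxBr mulmx1.
rewrite -scalemxAr trmx_delta map_delta_mx mulmxA -(colE t (elim M t)).
have -> : col t (elim M t) = 0; last by rewrite mul0mx scaler0 subr0.
apply/colP => i; rewrite !mxE big_ord1 !mxE psdform_diag_real //.
by rewrite mulrCA mulVf // mulr1 subrr.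
Qed.

Lemma tr_elim_le (C : numClosedFieldType) n (M : 'M[C]_n) t : psdform M ->
  \tr (elim M t) <= \tr M.
Proof.
move=> pM; have := psdform_tr_ge0 (psdform_subelim t pM).
by rewrite raddfB /= subr_ge0.
Qed.

Lemma sub_elim (C : numClosedFieldType) n (A M : 'M[C]_n) t :
  A - elim M t = (A - M) + (M - elim M t).
Proof. by rewrite addrA subrK. Qed.

Lemma psdform_sub_elim (C : numClosedFieldType) n (A M : 'M[C]_n) t :
  psdform M -> psdform (A - M) -> psdform (A - elim M t).
Proof.
move=> pM pAM; rewrite sub_elim.
exact/psdformD/psdform_subelim.
Qed.

Lemma rank_sub_elim (C : numClosedFieldType) n (A M : 'M[C]_n) t :
  (\rank (A - elim M t)%R <= (\rank (A - M)%R).+1)%N.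
Proof.
rewrite sub_elim -addn1; apply: leq_trans (mxrank_add _ _) _; rewrite leq_add2l.
rewrite /elim opprB addrCA subrr addr0.
apply: leq_trans (mxrank_scale _ _) _; apply: leq_trans (mxrankM_maxl _ _) _.
exact: rank_leq_col.
Qed.

(** * Ridge determinants and the effective dimension *)

(** Both sides are the determinant of the block matrix with rows (1, -v) and
    (u, 1), factored in the two possible orders. *)
Lemma det1_rank1 (K : comPzRingType) n (u : 'cV[K]_n) (v : 'rV[K]_n) :
  \det (1%:M + u *m v) = 1 + (v *m u) 0 0.
Proof.
have := congr1 determinant (_ :
  block_mx 1%:M 0 u 1%:M *m block_mx 1%:M (- v) 0 (1%:M + u *m v) =
  block_mx 1%:M (- v) 0 1%:M *m block_mx (1%:M + v *m u) 0 u 1%:M :> 'M[K]_(1 + n)).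
rewrite !det_mulmx !det_ublock !det_lblock !det1 !mul1r !mulr1 => -> //.
  by rewrite det_mx11 mxE mxE eqxx.
rewrite !mulmx_block !(mul1mx, mulmx1, mul0mx, mulmx0, addr0, add0r, mulNmx, mulmxN).
by rewrite addrK [- (u *m v) + _]addrCA addNr addr0.
Qed.

Lemma det_rank1 (K : fieldType) n (M : 'M[K]_n) (u : 'cV[K]_n) (v : 'rV[K]_n) :
  M \in unitmx ->
  \det (M + u *m v) = \det M * (1 + (v *m invmx M *m u) 0 0).
Proof.
move=> Mu; rewrite -mulmxA -det1_rank1 -det_mulmx.
by rewrite mulmxDr mulmx1 !mulmxA mulmxV // mul1mx.
Qed.

Lemma ridge_fmx (C : numClosedFieldType) n (M : 'M[C]_n) nu : M ^t* = M ->
  M + nu%:M = fmx M (fun x => x + nu).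
Proof. by move=> Mh; rewrite -(fmx_cst M nu) -[in LHS](fmx_id Mh) -fmxD (fmx_id Mh). Qed.

Lemma ridge_inv (C : numClosedFieldType) n (M : 'M[C]_n) nu : psdform M -> 0 < nu ->
  M + nu%:M \in unitmx /\ invmx (M + nu%:M) = fmx M (fun x => (x + nu)^-1).
Proof.
move=> pM nu0; have [Mh _] := pM; rewrite ridge_fmx //.
by apply: fmx_inv => i; rewrite gt_eqF // ltr_wpDl ?spectral_diag_ge0.
Qed.

Lemma ridge_det_spectral (C : numClosedFieldType) n (M : 'M[C]_n) nu : M ^t* = M ->
  \det (M + nu%:M) = \prod_i (spectral_diag M 0 i + nu).
Proof. by move=> Mh; rewrite ridge_fmx // fmx_det. Qed.

Lemma ridge_det_ge0 (C : numClosedFieldType) n (M : 'M[C]_n) nu : psdform M -> 0 < nu ->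
  0 <= \det (M + nu%:M).
Proof.
move=> pM nu0; have [Mh _] := pM; rewrite ridge_det_spectral // prodr_ge0 // => i _.
by rewrite addr_ge0 ?spectral_diag_ge0 // ltW.
Qed.

Lemma ridge_leverage (C : numClosedFieldType) n (M : 'M[C]_n) nu : psdform M -> 0 < nu ->
  M *m invmx (M + nu%:M) = fmx M (fun x => x / (x + nu)).
Proof.
move=> pM nu0; have [_ ->] := ridge_inv pM nu0; have [Mh _] := pM.
by rewrite -[X in X *m _](fmx_id Mh) fmxM.
Qed.

Lemma psdform_leverage (C : numClosedFieldType) n (M : 'M[C]_n) nu :
  psdform M -> 0 < nu -> psdform (M *m invmx (M + nu%:M)).
Proof.
move=> pM nu0; rewrite ridge_leverage //; apply: psdform_fmx => i.
by rewrite divr_ge0 ?addr_ge0 ?spectral_diag_ge0 // ltW.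
Qed.

(** The rank-one determinant formula, with M - M (M + nu)^-1 M = nu M (M + nu)^-1.
    It is an equality when M t t is positive. *)
Lemma det_elim_le (C : numClosedFieldType) n (M : 'M[C]_n) nu t :
  psdform M -> 0 < nu ->
  M t t * \det (elim M t + nu%:M) <=
  nu * \det (M + nu%:M) * (M *m invmx (M + nu%:M)) t t.
Proof.
move=> pM nu0; have [Mh _] := pM; have [Mnu iM] := ridge_inv pM nu0.
have Mdet := ridge_det_ge0 pM nu0.
have [Mt0|Mt0] := eqVneq (M t t) 0.
  rewrite Mt0 mul0r !mulr_ge0 ?(ltW nu0) //.
  exact/psdform_diag_ge0/psdform_leverage.
have -> : elim M t + nu%:M = (M + nu%:M) + (- (M t t)^-1 *: col t M) *m (row t M).
  by rewrite hermitian_row // /elim addrAC -scalemxAl scaleNr.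
rewrite det_rank1 // mulrCA [nu * _]mulrC -mulrA ler_wpM2l //.
rewrite -scalemxAr mxE mulrDr mulr1 mulrA mulrN divff // mulN1r.
have -> : (row t M *m invmx (M + nu%:M) *m col t M) 0 0 =
    (M *m invmx (M + nu%:M) *m M) t t.
  by rewrite -row_mul colE mulmxA -row_mul -colE !mxE.
rewrite le_eqVlt; apply/orP; left; apply/eqP.
have -> : nu * (M *m invmx (M + nu%:M)) t t =
   ((M *m invmx (M + nu%:M)) *m nu%:M) t t by rewrite mul_mx_scalar [RHS]mxE.
have -> : M *m invmx (M + nu%:M) *m nu%:M = M - M *m invmx (M + nu%:M) *m M.
  by apply/eqP; rewrite eq_sym subr_eq -mulmxDr [nu%:M + M]addrC mulmxKV.
by rewrite !mxE.
Qed.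

Definition effdim (C : numClosedFieldType) n (M : 'M[C]_n) (nu : C) : C :=
  \tr (M *m invmx (M + nu%:M)).

Lemma effdim_ge0 (C : numClosedFieldType) n (M : 'M[C]_n) nu :
  psdform M -> 0 < nu -> 0 <= effdim M nu.
Proof. by move=> pM nu0; apply/psdform_tr_ge0/psdform_leverage. Qed.

Lemma effdimE (C : numClosedFieldType) n (M : 'M[C]_n) nu : psdform M -> 0 < nu ->
  effdim M nu = \sum_i (spectral_diag M 0 i / (spectral_diag M 0 i + nu)).
Proof. by move=> pM nu0; rewrite /effdim ridge_leverage // fmx_tr. Qed.

(** With X1 = (M + nu)^-1 and X2 = (A + nu)^-1 one has
    X1 - X2 = X2 (A - M) X2 + (X1 - X2) (M + nu) (X1 - X2),
    which is positive semidefinite; so inversion reverses the order. *)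
Lemma effdim_mono (C : numClosedFieldType) n (M A : 'M[C]_n) nu :
  psdform M -> psdform (A - M) -> 0 < nu -> effdim M nu <= effdim A nu.
Proof.
move=> pM pAM nu0.
have pA : psdform A by rewrite -(subrK M A); apply: psdformD.
have rep (X : 'M[C]_n) :psdform X -> effdim X nu = n%:R - nu * \tr (invmx (X + nu%:M)).
  move=> pX; have [Xu _] := ridge_inv pX nu0.
  rewrite /effdim -{1}(addrK nu%:M X) mulmxBl mulmxV // mul_scalar_mx raddfB /=.
  by rewrite mxtrace1 mxtraceZ.
rewrite !rep // lerD2l lerN2 ler_wpM2l ?(ltW nu0) // -subr_ge0 -linearB /=.
have [Mu iM] := ridge_inv pM nu0; have [Au iA] := ridge_inv pA nu0.
have adjinv (X : 'M[C]_n) :psdform X -> (invmx (X + nu%:M)) ^t* = invmx (X + nu%:M).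
  move=> pX; have [_ ->] := ridge_inv pX nu0.
  apply: fmx_adj => i; rewrite ger0_real // invr_ge0 addr_ge0 ?spectral_diag_ge0 //.
  exact: ltW.
have MA : psdform (M + nu%:M).
  apply: psdformD => //; rewrite -scalemx1; apply: psdformZ (psdform1 _ _).
  exact: ltW.
apply: psdform_tr_ge0.
set X1 := invmx (M + nu%:M); set X2 := invmx (A + nu%:M).
have -> : X1 - X2 = X2 *m (A - M) *m X2 ^t* + (X1 - X2) *m (M + nu%:M) *m (X1 - X2) ^t*.
  rewrite adjmxB !adjinv // -/X1 -/X2.
  have -> : A - M = (A + nu%:M) - (M + nu%:M) by rewrite opprD addrACA subrr addr0.
  have -> : X2 *m (A + nu%:M - (M + nu%:M)) *m X2 = X2 - X2 *m (M + nu%:M) *m X2.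
    by rewrite mulmxBr mulVmx // mulmxBl mul1mx.
  rewrite [(X1 - X2) *m _]mulmxBl mulVmx // mulmxBr !mulmxBl !mul1mx.
  by rewrite -(mulmxA X2 _ X1) mulmxV // mulmx1 [RHS]addrC subrK.
apply: psdformD; exact: psdform_congr.
Qed.

(** The drift of the determinant under one random pivot, up to the factor 1 / tr M. *)
Lemma det_elim_sum (C : numClosedFieldType) n (A M : 'M[C]_n) nu :
  psdform M -> psdform (A - M) -> 0 < nu ->
  \sum_t M t t * \det (elim M t + nu%:M) <= nu * effdim A nu * \det (M + nu%:M).
Proof.
move=> pM pAM nu0.
apply: le_trans (_ : \sum_t nu * \det (M + nu%:M) *
    (M *m invmx (M + nu%:M)) t t <= _).
  by apply: ler_sum => t _; apply: det_elim_le.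
rewrite -mulr_sumr -/(effdim M nu) mulrAC ler_wpM2r ?ridge_det_ge0 //.
by rewrite ler_wpM2l ?(ltW nu0) // effdim_mono.
Qed.

(** * The part of the spectrum above a threshold *)

Definition excess (C : numClosedFieldType) (theta x : C) : C :=
  if theta <= x then x - theta else 0.

Lemma excess_ge0 (C : numClosedFieldType) (theta x : C) : 0 <= excess theta x.
Proof. by rewrite /excess; case: ifP => // h; rewrite subr_ge0. Qed.

(** The trace of the positive part of M - theta, for a Hermitian M. *)
Definition excess_tr (C : numClosedFieldType) (theta : C) n (M : 'M[C]_n) : C :=
  \tr (fmx M (excess theta)).

Lemma psdform_excess (C : numClosedFieldType) (theta : C) n (M : 'M[C]_n) :
  psdform (fmx M (excess theta)).
Proof. by apply: psdform_fmx => i; apply: excess_ge0. Qed.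

Lemma excess_tr_ge0 (C : numClosedFieldType) (theta : C) n (M : 'M[C]_n) :
  0 <= excess_tr theta M.
Proof. exact/psdform_tr_ge0/psdform_excess. Qed.

(** Jensen's inequality for the trace.  Let E = S Q S with S the square root of M.
    On the eigenvectors of E with eigenvalue at least theta, T = Q S E^(-1/2) is an
    isometry into the range of Q which carries the form of M to that of E.  Hence the
    left-hand side is the trace of M - theta on the range of T.  This is at most the
    trace of the positive part of M - theta on that range, which lies in that of Q. *)
Lemma excess_compress (C : numClosedFieldType) (theta : C) n (M Q : 'M[C]_n) :
  0 < theta -> psdform M -> Q ^t* = Q -> Q *m Q = Q ->
  excess_tr theta (fmx M sqrtC *m Q *m fmx M sqrtC) <=
  \tr (Q *m fmx M (excess theta)).
Proof.
move=> th0 pM Qh QQ; have [Mh _] := pM.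
set S := fmx M sqrtC; set Y := fmx M (excess theta); set E := S *m Q *m S.
have Sh : S ^t* = S by apply: fmx_sqrt_adj.
have SS : S *m S = M by apply: fmx_sqrt_sqr.
have EQ : E = (S *m Q) *m (S *m Q) ^t*.
  by rewrite adjmxM Sh Qh mulmxA -(mulmxA S Q Q) QQ.
have pE : psdform E by rewrite EQ; apply: psdform_gram.
have [Eh _] := pE.
pose ind (x : C) : C := if theta <= x then 1 else 0.
pose g (x : C) := if theta <= x then (sqrtC x)^-1 else 0.
set G := fmx E g; set P := fmx E ind.
have Gh : G ^t* = G.
  apply: fmx_adj => i; rewrite /g; case: ifP => // h.
  by rewrite ger0_real // invr_ge0 sqrtC_ge0 spectral_diag_ge0.
have g2 (x : C) : g x * x * g x = ind x.
  rewrite /g /ind; case: ifP => [h|]; last by rewrite !mul0r.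
  have x0 : 0 < x := lt_le_trans th0 h.
  by rewrite mulrAC -invfM -expr2 sqrtCK mulVf // gt_eqF.
(* G is E^(-1/2) cut off below theta, so T^* T = P is a spectral projection of E. *)
set T := Q *m S *m G.
have Tadj : T ^t* = G *m S *m Q by rewrite /T (adjmxM (Q *m S) G) (adjmxM Q S) Gh Sh Qh mulmxA.
have TT : T ^t* *m T = P.
  have -> : T ^t* *m T = G *m E *m G.
    by rewrite Tadj /T /E !mulmxA -(mulmxA _ Q Q) QQ.
  by rewrite -[X in G *m X *m G](fmx_id Eh) !fmxM; apply: eq_fmx => i; rewrite g2.
have TP : T *m P = T.
  rewrite /T -mulmxA fmxM; congr (_ *m _); apply: eq_fmx => i.
  by rewrite /g /ind; case: ifP => _; rewrite ?mulr1 ?mulr0.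
have TMT : T ^t* *m M *m T = fmx E (fun x => ind x * x).
  have -> : T ^t* *m M *m T = G *m E *m E *m G.
    by rewrite Tadj /T /E -SS !mulmxA.
  rewrite -[X in G *m X](fmx_id Eh) -[X in _ *m X *m G](fmx_id Eh) !fmxM.
  by apply: eq_fmx => i; rewrite -(g2 (spectral_diag E 0 i)); ring.
have -> : excess_tr theta E = \tr (T ^t* *m (M - theta%:M) *m T).
  rewrite mulmxBr mulmxBl TMT mul_mx_scalar -scalemxAl TT.
  rewrite /excess_tr raddfB /= mxtraceZ !fmx_tr mulr_sumr -sumrB.
  apply: eq_bigr => i _; rewrite /excess /ind.
  by case: ifP => _; rewrite ?mul1r ?mulr1 ?mul0r ?mulr0 ?subrr.
have pY : psdform (Y - (M - theta%:M)).
  have -> : Y - (M - theta%:M) = fmx M (fun x => excess theta x + (-1) * x + theta).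
    rewrite -(fmx_cst M theta) -[X in _ - (X - _)](fmx_id Mh).
    rewrite -!fmxD -(fmxM M (fun=> -1) id) (fmx_cst M (-1)) opprD opprK addrA.
    by rewrite mul_scalar_mx scaleN1r (fmx_id Mh).
  apply: psdform_fmx => i; have evr := spectral_diag_real i Mh.
  rewrite mulN1r /excess; case: ifP => [_|/negbT]; first by rewrite addrAC subrK subrr.
  rewrite -real_ltNge ?(gtr0_real th0) // => /ltW lt; by rewrite add0r addrC subr_ge0.
have le1 : \tr (T ^t* *m (M - theta%:M) *m T) <= \tr (T ^t* *m Y *m T).
  have := psdform_tr_ge0 (psdform_congr (T ^t*) pY).
  by rewrite trmxCK mulmxBr mulmxBl raddfB /= subr_ge0.
apply: le_trans le1 _.
have -> : \tr (T ^t* *m Y *m T) = \tr (T *m T ^t* *m Y).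
  by rewrite mxtrace_mulC mulmxA.
set PI := T *m T ^t*.
have PIh : PI ^t* = PI by rewrite /PI adjmxM trmxCK.
have PIPI : PI *m PI = PI.
  by rewrite /PI mulmxA -(mulmxA T _ T) TT TP.
have QPI : Q *m PI = PI by rewrite /PI /T !mulmxA QQ.
have PIQ : PI *m Q = PI by rewrite -[LHS]trmxCK adjmxM Qh PIh QPI.
(* PI = T T^* is the orthogonal projection onto the range of T. *)
have pQ : psdform (Q - PI).
  have -> : Q - PI = (Q - PI) *m (Q - PI) ^t*.
    rewrite adjmxB Qh PIh mulmxBr !mulmxBl QQ PIPI QPI PIQ subrr subr0 //.
  exact: psdform_gram.
have := psdform_trM_ge0 pQ (psdform_excess theta M).
by rewrite mulmxBl raddfB /= subr_ge0.
Qed.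

(** With S the square root of M and u = S e_t, the step yields S Q S, where Q is
    the orthogonal projection along u. *)
Lemma excess_tr_elim_le (C : numClosedFieldType) (theta : C) n (M : 'M[C]_n) t :
  0 < theta -> psdform M ->
  M t t * excess_tr theta (elim M t) <=
  M t t * excess_tr theta M - (M *m fmx M (excess theta)) t t.
Proof.
move=> th0 pM; have [Mh _] := pM.
set S := fmx M sqrtC; set Y := fmx M (excess theta).
have Sh : S ^t* = S by apply: fmx_sqrt_adj.
have SS : S *m S = M by apply: fmx_sqrt_sqr.
set u := col t S; have uh : u ^t* = row t S by rewrite hermitian_row.
have uu : (u ^t* *m u) 0 0 = M t t.
  by rewrite uh /u -row_mul colE mulmxA SS -colE !mxE.
have MYt : (M *m Y) t t = (u ^t* *m Y *m u) 0 0.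
  have -> : M *m Y = S *m Y *m S.
    rewrite -[X in X *m Y](fmx_id Mh) !fmxM; apply: eq_fmx => i.
    by rewrite mulrAC -expr2 sqrtCK.
  by rewrite uh /u -row_mul colE mulmxA -row_mul -colE !mxE.
have [Mt0|Mt0] := eqVneq (M t t) 0.
  have u0 : u ^t* = 0.
    apply/eqP/negPn/negP => /norm2_gt0; rewrite trmxCK uu Mt0 ltxx.
    by [].
  by rewrite MYt u0 !mul0mx mxE Mt0 !mul0r subr0.
pose Q := 1%:M - (M t t)^-1 *: (u *m u ^t*).
have Mtr := psdform_diag_real t pM.
have Qh : Q ^t* = Q.
  by rewrite /Q adjmxB adjmxZ adjmx_scalar conjC1 fmorphV /= Mtr adjmxM trmxCK.
have QQ : Q *m Q = Q.
  have uQ : u ^t* *m Q = 0.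
    rewrite /Q mulmxBr mulmx1 -scalemxAr mulmxA.
    rewrite (mx11_scalar (u ^t* *m u)) uu mul_scalar_mx scalerA mulVf //.
    by rewrite scale1r subrr.
  by rewrite {1}/Q mulmxBl mul1mx -scalemxAl -mulmxA uQ mulmx0 scaler0 subr0.
have -> : elim M t = S *m Q *m S.
  rewrite /Q mulmxBr mulmx1 mulmxBl SS -scalemxAr -scalemxAl /elim; congr (_ - _ *: _).
  have -> : col t M = S *m u by rewrite /u !colE mulmxA SS.
  by rewrite adjmxM Sh !mulmxA.
apply: le_trans (_ : M t t * \tr (Q *m Y) <= _).
  by rewrite ler_wpM2l ?psdform_diag_ge0 // excess_compress.
rewrite /Q mulmxBl mul1mx raddfB /= mulrBr -scalemxAl mxtraceZ mulrA mulfV // mul1r.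
by rewrite MYt -(mulmxA u) (mxtrace_mulC u) trace_mx11.
Qed.

(** The drift of the potential: on the support of the excess, the eigenvalues
    are at least theta. *)
Lemma excess_tr_elim_sum (C : numClosedFieldType) (theta : C) n (M : 'M[C]_n) :
  0 < theta -> psdform M ->
  \sum_t M t t * excess_tr theta (elim M t) <=
  (\tr M - theta) * excess_tr theta M.
Proof.
move=> th0 pM; have [Mh _] := pM.
apply: le_trans (_ : \sum_t (M t t * excess_tr theta M -
    (M *m fmx M (excess theta)) t t) <= _).
  by apply: ler_sum => t _; apply: excess_tr_elim_le.
rewrite sumrB -mulr_suml mulrBl lerD2l lerN2 -/(\tr (M *m _)).
rewrite -[X in X *m _](fmx_id Mh) fmxM /excess_tr !fmx_tr mulr_sumr.
apply: ler_sum => i _; rewrite /excess; case: ifP => h; last by rewrite !mulr0.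
by rewrite ler_wpM2r // subr_ge0.
Qed.

Lemma excess_tr_le (C : numClosedFieldType) (theta : C) n (M : 'M[C]_n) :
  0 < theta -> psdform M -> excess_tr theta M <= \tr M.
Proof.
move=> th0 pM; have [Mh _] := pM.
rewrite hermitian_tr // /excess_tr fmx_tr; apply: ler_sum => i _.
rewrite /excess; case: ifP => _; last exact: spectral_diag_ge0.
by rewrite gerDl oppr_le0 ltW.
Qed.

Lemma excess_tr_small (C : numClosedFieldType) (theta c : C) n (M : 'M[C]_n) :
  0 < theta -> psdform M -> c \is Num.real -> excess_tr theta M < c - theta ->
  psdform (c%:M - M).
Proof.
move=> th0 pM cr lt; have [Mh _] := pM; apply: spectral_diag_le_psdform => // i.
rewrite real_leNgt ?(spectral_diag_real i Mh) //; apply/negP => ci.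
have cth : theta < c.
  by rewrite -subr_gt0; apply: le_lt_trans lt; apply: excess_tr_ge0.
have r1 : c - theta \is Num.real by rewrite realB // gtr0_real.
have r2 : excess_tr theta M \is Num.real by rewrite ger0_real ?excess_tr_ge0.
move: lt; apply/negP; rewrite -real_leNgt //.
rewrite /excess_tr fmx_tr (bigD1 i) //= ler_wpDr ?sumr_ge0 // => [j _|].
  exact: excess_ge0.
by rewrite /excess (ltW (lt_trans cth ci)) lerD2r ltW.
Qed.

(** * The trace of a residual of low rank *)

(** If all the eigenvalues of A indexed by J exceeded tr M: the span of their
    eigenvectors has larger dimension than the rank of A - M, so it contains a
    nonzero vector v on which A and M have the same form, and that form is at once
    larger than tr M |v|^2 because of A and at most tr M |v|^2 because of M. *)
Lemma spectral_diag_le_residual_tr (C : numClosedFieldType) n (A M : 'M[C]_n) (J : {set 'I_n}) :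
  A ^t* = A -> psdform M -> (\rank (A - M)%R < #|J|)%N ->
  exists2 j, j \in J & spectral_diag A 0 j <= \tr M.
Proof.
move=> Ah pM rk; apply/exists_inP; rewrite -[X in is_true X]negbK negb_exists_in.
apply/negP => /forall_inP H.
pose f (i : 'I_#|J|) : 'I_n := enum_val i.
pose W : 'M[C]_(#|J|, n) := rowsub f (spectralmx A).
pose D : 'M[C]_#|J| := diag_mx (\row_i spectral_diag A 0 (f i)).
have WW : W *m W ^t* = 1%:M.
  apply/matrixP => i j; rewrite !mxE.
  have /matrixP/(_ (f i) (f j)) := spectralmx_mulV A; rewrite !mxE (inj_eq enum_val_inj) => <-.
  by apply: eq_bigr => k _; rewrite !mxE.
have WA : W *m A = D *m W.
  apply/row_matrixP => i; rewrite row_mul.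
  have -> : row i W = row (f i) (spectralmx A) by apply/rowP => k; rewrite !mxE.
  rewrite spectral_row //; apply/rowP => k.
  by rewrite /D mul_diag_mx !mxE.
have : kermx (W *m (A - M)) != 0.
  rewrite kermx_eq0 /row_free neq_ltn (leq_ltn_trans _ rk) //.
  exact: mxrankM_maxr.
move=> /rowV0Pn[c /sub_kermxP cK c0].
pose v := c *m W.
have vAM : v *m A *m v ^t* = v *m M *m v ^t*.
  apply/eqP; rewrite -subr_eq0 -mulmxBl -mulmxBr /v -(mulmxA c W) cK.
  by rewrite mul0mx.
have vv : v *m v ^t* = c *m c ^t*.
  by rewrite /v adjmxM mulmxA -(mulmxA c W) WW mulmx1.
have vAv : v *m A *m v ^t* = c *m D *m c ^t*.
  by rewrite /v adjmxM -(mulmxA c W) WA !mulmxA -(mulmxA _ W) WW mulmx1.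
have [_ /(_ v)] := psdform_le_tr pM.
rewrite mulmxBr mulmxBl -vAM mul_mx_scalar -scalemxAl vv vAv.
apply/negP; rewrite !mxE mulr_sumr -sumrB.
have [i ci] : exists i, c 0 i != 0 by apply/rV0Pn.
have ev_gt (k : 'I_#|J|) : \tr M < spectral_diag A 0 (f k).
  have := H (f k) (enum_valP k).
  by rewrite -real_ltNge ?(spectral_diag_real _ Ah) ?ger0_real ?psdform_tr_ge0.
have termE k : \tr M * (c 0 k * (c ^t*) k 0) - (c *m D) 0 k * (c ^t*) k 0 =
    (\tr M - spectral_diag A 0 (f k)) * (c 0 k * (c 0 k)^*).
  by rewrite /D mul_mx_diag !mxE; ring.
under eq_bigr do rewrite termE.
have neg k : (\tr M - spectral_diag A 0 (f k)) * (c 0 k * (c 0 k)^*) <= 0.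
  by rewrite mulr_le0_ge0 ?mul_conjC_ge0 // subr_le0 ltW.
rewrite lt_geF // (bigD1 i) //= ltr_wnDr ?sumr_le0 //.
by rewrite nmulr_rlt0 ?subr_lt0 // mul_conjC_gt0.
Qed.

(** * Real-valued quantities of the residuals *)

Lemma Re_ge0K (R : realType) (z : R[i]) : 0 <= z -> (complex.Re z)%:C = z.
Proof. by move=> z0; rewrite RRe_real // ger0_real. Qed.

Lemma real_complex_gt0 (R : realType) (x : R) : (0 < x%:C) = (0 < x).
Proof. exact: (ltcR 0 x). Qed.

Definition residual (R : realType) N (A : 'M[R[i]]_N) (h : seq 'I_N) : 'M[R[i]]_N :=
  A - rpc_approx A h.

Lemma residual_nil (R : realType) N (A : 'M[R[i]]_N) : residual A [::] = A.
Proof. by rewrite /residual /rpc_approx subr0. Qed.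

Lemma residual_rcons (R : realType) N (A : 'M[R[i]]_N) h t :
  residual A (rcons h t) = elim (residual A h) t.
Proof.
rewrite /residual /rpc_approx foldl_rcons -/(rpc_approx A h) /rpc_step.
set M := A - rpc_approx A h; case: eqP => [M0|_].
  by rewrite M0 /elim mxE invr0 scale0r subr0.
by rewrite opprD addrA /elim mxE.
Qed.

Lemma psdform_residual (R : realType) N (A : 'M[R[i]]_N) h :
  psdform A -> psdform (residual A h) /\ psdform (A - residual A h).
Proof.
move=> pA; elim/last_ind: h => [|h t [pM pAM]].
  by rewrite residual_nil; split; [exact: pA | exact: psdform_subrr].
rewrite residual_rcons; split; first exact: psdform_elim.
exact: psdform_sub_elim.
Qed.

Lemma rank_residual (R : realType) N (A : 'M[R[i]]_N) h :
  (\rank (A - residual A h)%R <= size h)%N.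
Proof.
elim/last_ind: h => [|h t IH].
  by rewrite residual_nil [A - A](@subrr _ A) mxrank0.
rewrite residual_rcons size_rcons.
exact: leq_trans (rank_sub_elim _ _ _) _.
Qed.

Definition real_tr (R : realType) n (M : 'M[R[i]]_n) : R := complex.Re (\tr M).

Definition ridge_det (R : realType) n (mu : R) (M : 'M[R[i]]_n) : R :=
  complex.Re (\det (M + (mu%:C)%:M)).

Definition excess_mass (R : realType) n (theta : R) (M : 'M[R[i]]_n) : R :=
  complex.Re (excess_tr theta%:C M).

Lemma real_trE (R : realType) n (M : 'M[R[i]]_n) : psdform M -> (real_tr M)%:C = \tr M.
Proof. by move=> pM; rewrite Re_ge0K ?psdform_tr_ge0. Qed.

Lemma real_diagE (R : realType) n (M : 'M[R[i]]_n) t : psdform M ->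
  (complex.Re (M t t))%:C = M t t.
Proof. by move=> pM; rewrite Re_ge0K ?psdform_diag_ge0. Qed.

Lemma ridge_detE (R : realType) n (mu : R) (M : 'M[R[i]]_n) : 0 < mu -> psdform M ->
  (ridge_det mu M)%:C = \det (M + (mu%:C)%:M).
Proof.
move=> mu0 pM; by rewrite Re_ge0K // ridge_det_ge0 ?real_complex_gt0.
Qed.

Lemma excess_massE (R : realType) n (theta : R) (M : 'M[R[i]]_n) :
  (excess_mass theta M)%:C = excess_tr theta%:C M.
Proof. by rewrite Re_ge0K ?excess_tr_ge0. Qed.

Lemma deffE (R : realType) n (mu : R) (A : 'M[R[i]]_n) : 0 < mu -> psdform A ->
  (deff A mu)%:C = effdim A mu%:C.
Proof. by move=> mu0 pA; rewrite Re_ge0K ?effdim_ge0 ?real_complex_gt0. Qed.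

Lemma ridge_det_elim_sum (R : realType) n (mu : R) (M A : 'M[R[i]]_n) : 0 < mu ->
  psdform M -> psdform (A - M) ->
  \sum_t complex.Re (M t t) * ridge_det mu (elim M t) <= mu * deff A mu * ridge_det mu M.
Proof.
move=> mu0 pM pAM.
have muC : 0 < mu%:C by rewrite real_complex_gt0.
have pA : psdform A by rewrite -(subrK M A); apply: psdformD.
rewrite -lecR rmorph_sum !rmorphM /= deffE // ridge_detE //.
apply: le_trans (det_elim_sum pM pAM muC).
apply: ler_sum => t _.
by rewrite rmorphM /= (real_diagE t pM) (ridge_detE mu0 (psdform_elim t pM)).
Qed.

Lemma excess_mass_elim_sum (R : realType) n (theta : R) (M : 'M[R[i]]_n) : 0 < theta ->
  psdform M ->
  \sum_t complex.Re (M t t) * excess_mass theta (elim M t) <=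
  (real_tr M - theta) * excess_mass theta M.
Proof.
move=> th0 pM; have thC : 0 < theta%:C by rewrite real_complex_gt0.
rewrite -lecR rmorph_sum rmorphM rmorphB /= excess_massE real_trE //.
apply: le_trans (excess_tr_elim_sum thC pM).
by apply: ler_sum => t _; rewrite rmorphM /= real_diagE // excess_massE.
Qed.

Lemma excess_mass_le (R : realType) n (theta : R) (M : 'M[R[i]]_n) : 0 < theta ->
  psdform M -> 0 <= excess_mass theta M <= real_tr M.
Proof.
move=> th0 pM; rewrite -ler0c -lecR excess_massE real_trE // excess_tr_ge0 /=.
by rewrite excess_tr_le ?real_complex_gt0.
Qed.

(** An eigenvalue above c alone contributes c - theta to the excess. *)
Lemma excess_mass_small (R : realType) n (theta c : R) (M : 'M[R[i]]_n) : 0 < theta ->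
  psdform M -> excess_mass theta M < c - theta -> psdform ((c%:C)%:M - M).
Proof.
move=> th0 pM; rewrite -ltcR rmorphB /= excess_massE => lt.
apply: excess_tr_small lt => //; first by rewrite real_complex_gt0.
by apply/complex_realP; exists c.
Qed.

Lemma real_tr_ge0 (R : realType) n (M : 'M[R[i]]_n) : psdform M -> 0 <= real_tr M.
Proof. by move=> pM; rewrite -ler0c real_trE // psdform_tr_ge0. Qed.

Lemma real_tr_elim_le (R : realType) n (M : 'M[R[i]]_n) t : psdform M ->
  real_tr (elim M t) <= real_tr M.
Proof.
move=> pM; have pE := psdform_elim t pM.
rewrite -lecR (real_trE pE) (real_trE pM).
exact: tr_elim_le.
Qed.

Lemma real_tr_gt0 (R : realType) n (M : 'M[R[i]]_n) : psdform M -> M <> 0 -> 0 < real_tr M.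
Proof.
move=> pM M0; rewrite lt_neqAle real_tr_ge0 // andbT eq_sym; apply/eqP => t0.
by apply/M0/psdform_tr0; rewrite // -real_trE // t0.
Qed.

Definition eigval (R : realType) n (M : 'M[R[i]]_n) (i : 'I_n) : R :=
  complex.Re (spectral_diag M 0 i).

Lemma eigvalE (R : realType) n (M : 'M[R[i]]_n) i : psdform M ->
  (eigval M i)%:C = spectral_diag M 0 i.
Proof. by move=> pM; rewrite Re_ge0K ?spectral_diag_ge0. Qed.

Lemma eigval_ge0 (R : realType) n (M : 'M[R[i]]_n) i : psdform M -> 0 <= eigval M i.
Proof. by move=> pM; rewrite -ler0c eigvalE // spectral_diag_ge0. Qed.

Lemma ridge_det_prod (R : realType) n (mu : R) (M : 'M[R[i]]_n) : 0 < mu -> psdform M ->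
  ridge_det mu M = \prod_i (eigval M i + mu).
Proof.
move=> mu0 pM; have [Mh _] := pM.
apply: complexI; rewrite ridge_detE // ridge_det_spectral //.
by rewrite rmorph_prod; apply: eq_bigr => i _; rewrite rmorphD /= eigvalE.
Qed.

Lemma deff_sum (R : realType) n (mu : R) (A : 'M[R[i]]_n) : 0 < mu -> psdform A ->
  deff A mu = \sum_i (eigval A i / (eigval A i + mu)).
Proof.
move=> mu0 pA; apply: complexI; rewrite deffE // effdimE ?real_complex_gt0 //.
by rewrite rmorph_sum; apply: eq_bigr => i _; rewrite fmorph_div rmorphD /= eigvalE.
Qed.

Lemma eigval_le_psdform (R : realType) n (c : R) (A : 'M[R[i]]_n) : psdform A ->
  (forall i, eigval A i <= c) -> psdform ((c%:C)%:M - A).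
Proof.
move=> pA le; apply: spectral_diag_le_psdform => [|i]; first by case: pA.
by rewrite -eigvalE // lecR.
Qed.

Lemma eigval_le_residual (R : realType) n (A : 'M[R[i]]_n) (J : {set 'I_n}) h :
  psdform A -> (size h < #|J|)%N ->
  exists2 j, j \in J & eigval A j <= real_tr (residual A h).
Proof.
move=> pA hJ; have [pM _] := psdform_residual h pA.
have rk := leq_ltn_trans (rank_residual A h) hJ.
have [|j jJ le] := spectral_diag_le_residual_tr _ pM rk; first by case: pA.
by exists j => //; rewrite -lecR eigvalE // real_trE.
Qed.

(** * The spectrum of the preconditioned matrix *)

(** If v is an eigenvector and y = v B, then B G B = 1 turns the norm of v into the
    form of G at y, and x times that norm into the form of A + mu at y.  These two
    forms compare as G <= A + mu <= 2 G. *)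
Lemma precond_ev_bounds (C : numClosedFieldType) n (A Ah : 'M[C]_n) (mu x : C) :
  0 < mu -> psdform Ah -> psdform (A - Ah) -> psdform (mu%:M - (A - Ah)) ->
  let G := Ah + mu%:M in
  let B := fmx G (fun z => (sqrtC z)^-1) in
  eigenvalue (B *m (A + mu%:M) *m B) x -> 1 <= x <= 2.
Proof.
move=> mu0 pAh pAAh pmu G B /eigenvalueP[v vx v0].
have pG : psdform G.
  apply: psdformD => //; rewrite -scalemx1; apply: psdformZ (psdform1 _ _).
  exact: ltW.
have [Gh _] := pG.
have evG i : 0 < spectral_diag G 0 i.
  apply: lt_le_trans mu0 _; rewrite -subr_ge0 -spectral_row_form //.
  have [_ /(_ (row i (spectralmx G)))] := pAh.
  have -> : Ah = G - mu%:M by rewrite addrK.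
  rewrite mulmxBr mulmxBl [X in 0 <= X]mxE [X in _ + X]mxE mul_mx_scalar -scalemxAl.
  by rewrite [X in _ - X]mxE spectral_row_norm mulr1.
have Bh : B ^t* = B.
  by apply: fmx_adj => i; rewrite ger0_real // invr_ge0 sqrtC_ge0 ltW.
have BGB : B *m G *m B = 1%:M.
  rewrite -[X in B *m X](fmx_id Gh) !fmxM -(fmx_cst G 1); apply: eq_fmx => i.
  by rewrite mulrAC -invfM -expr2 sqrtCK mulVf // gt_eqF.
have GE : G = Ah + mu%:M by [].
clearbody B; clearbody G.
pose y := v *m B.
have yh : y ^t* = B *m v ^t* by rewrite adjmxM Bh.
have vv : (v *m v ^t*) 0 0 = (y *m G *m y ^t*) 0 0.
  by rewrite yh /y !mulmxA -(mulmxA v B G) -(mulmxA v (B *m G)) BGB mulmx1.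
have xvv : x * (v *m v ^t*) 0 0 = (y *m (A + mu%:M) *m y ^t*) 0 0.
  by rewrite yh /y !mulmxA -(mulmxA v B) -(mulmxA v (B *m _)) vx -scalemxAl [RHS]mxE.
have vgt := norm2_gt0 v0.
rewrite -(ler_pM2r vgt) -[X in _ && X](ler_pM2r vgt) xvv mul1r vv.
have sub_form (X Y : 'M[C]_n) : psdform (X - Y) ->
    (y *m Y *m y ^t*) 0 0 <= (y *m X *m y ^t*) 0 0.
  move=> [_ /(_ y)]; rewrite mulmxBr mulmxBl [X in 0 <= X]mxE [X in _ + X]mxE.
  by rewrite subr_ge0.
apply/andP; split.
  by apply: sub_form; rewrite GE opprD addrACA subrr addr0.
have -> : 2 * (y *m G *m y ^t*) 0 0 = (y *m (G + G) *m y ^t*) 0 0.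
  by rewrite mulmxDr mulmxDl [RHS]mxE mulr_natl mulr2n.
apply: sub_form.
have -> : G + G - (A + mu%:M) = Ah + (mu%:M - (A - Ah)).
  have GA : Ah + mu%:M - (A + mu%:M) = Ah - A by rewrite opprD addrACA subrr addr0.
  by rewrite GE -(addrA _ _ (- _)) GA opprB [RHS]addrA.
exact: psdformD.
Qed.

Lemma invsqrtmxE (R : realType) n (M : 'M[R[i]]_n) :
  invsqrtmx M = fmx M (fun z => (sqrtC z)^-1).
Proof. by rewrite /invsqrtmx invmx_unitary ?spectral_unitarymx. Qed.

(** When no real number is an eigenvalue, the supremum is 0 and so is the
    quotient. *)
Lemma cond_precond (R : realType) n (A Ah : 'M[R[i]]_n) (mu : R) :
  0 < mu -> psdform Ah -> psdform (A - Ah) -> psdform ((mu%:C)%:M - (A - Ah)) ->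
  cond (invsqrtmx (Ah + (mu%:C)%:M) *m (A + (mu%:C)%:M) *m
        invsqrtmx (Ah + (mu%:C)%:M)) <= 2.
Proof.
move=> mu0 pAh pAAh pmu; set B := invsqrtmx _; rewrite /cond /lambda_max /lambda_min.
have bnd x : eigenvalue (B *m (A + (mu%:C)%:M) *m B) x%:C -> 1 <= x <= 2.
  rewrite /B invsqrtmxE => /precond_ev_bounds; rewrite real_complex_gt0 => /(_ mu0 pAh pAAh pmu).
  rewrite -(lecR 1 x) -(lecR x 2).
  have -> : (2 : R)%:C = 2 by rewrite rmorph_nat.
  by [].
set E := [set x | _].
have [->|/set0P E0] := eqVneq E set0; first by rewrite sup0 mul0r.
have s2 : sup E <= 2 by apply: ge_sup => // x /bnd /andP[].
have i1 : 1 <= inf E by apply: lb_le_inf => // x /bnd /andP[].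
by rewrite ler_pdivrMr; [lra | lra].
Qed.

Lemma cond_residual_le2 (R : realType) N (A : 'M[R[i]]_N) (mu : R) h :
  psdform A -> 0 < mu -> psdform ((mu%:C)%:M - residual A h) ->
  cond (invsqrtmx (rpc_approx A h + (mu%:C)%:M) *m (A + (mu%:C)%:M) *m
        invsqrtmx (rpc_approx A h + (mu%:C)%:M)) <= 2.
Proof.
move=> pA mu0 pres; have [pM pAM] := psdform_residual h pA.
exact: (cond_precond mu0 (psdform_subK pAM) pM pres).
Qed.

(** * Expectations over the pivots *)

(** What the argument uses of the random pivots: q h is the probability that
    the first pivots are those of h. *)
Definition pivot_law (R : realType) N (A : 'M[R[i]]_N) (k : nat)
    (q : seq 'I_N -> R) : Prop :=
  [/\ q [::] = 1, forall h, 0 <= q h,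
      forall h, (size h < k)%N -> \sum_t q (rcons h t) = q h &
      forall h t, (size h < k)%N -> residual A h <> 0 ->
        q (rcons h t) = q h * (complex.Re (residual A h t t) / real_tr (residual A h))].

Lemma pivots_measurable (d : measure_display) (T : measurableType d) N
    (s : nat -> T -> 'I_N) (k : nat) :
  (forall i, (i < k)%N -> forall t, measurable [set w | s i w = t]) ->
  forall h, (size h <= k)%N -> measurable [set w | pivots s (size h) w = h].
Proof.
move=> ms; elim/last_ind => [|h t IH] hk.
  by rewrite (_ : [set w | _] = setT) //; apply/seteqP; split.
rewrite size_rcons in hk *.
rewrite (_ : [set w | _] = [set w | pivots s (size h) w = h] `&` [set w | s (size h) w = t]).
  by apply: measurableI; [apply/IH/ltnW | apply: ms].
apply/seteqP; split=> w; rewrite /= /pivots mkseqS.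
  by move=> /rcons_inj[].
by move=> [-> ->].
Qed.

Lemma pivots_prob_sum (R : realType) (d : measure_display) (T : measurableType d)
    (P : probability T R) N (s : nat -> T -> 'I_N) (k n : nat) (Q : pred (seq 'I_N)) :
  (forall i, (i < k)%N -> forall t, measurable [set w | s i w = t]) -> (n <= k)%N ->
  measurable [set w | Q (pivots s n w)] /\
  P [set w | Q (pivots s n w)] =
  (\sum_(h : n.-tuple 'I_N | Q h) fine (P [set w | pivots s n w = h]))%:E.
Proof.
move=> ms nk.
have mF (h : n.-tuple 'I_N) : measurable [set w | pivots s n w = h].
  by have := pivots_measurable ms (h := h); rewrite size_tuple => /(_ nk).
have -> : [set w | Q (pivots s n w)] =
    \bigcup_(h in [set` [pred h : n.-tuple 'I_N | Q h]]) [set w | pivots s n w = h].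
  apply/seteqP; split=> w /=.
    have sz : size (pivots s n w) == n by rewrite size_mkseq.
    by move=> Qw; exists (Tuple sz).
  by move=> [h /= Qh ->].
have fin : finite_set [set` [pred h : n.-tuple 'I_N | Q h]] by exact: finite_finset.
split; first exact: fin_bigcup_measurable.
rewrite measure_fin_bigcup //; last first.
  by move=> h1 h2 _ _ [w [/= e1 e2]]; apply: val_inj; rewrite /= -e1 -e2.
rewrite -(bigfs _ (r := index_enum _)) ?index_enum_uniq //; last first.
  by move=> h _; rewrite mem_index_enum.
rewrite -sumEFin; apply: eq_bigr => h _; rewrite fineK //.
exact: fin_num_measure.
Qed.

Lemma rpc_pivots_law (R : realType) (d : measure_display) (T : measurableType d)
    (P : probability T R) N (A : 'M[R[i]]_N) (k : nat) (s : nat -> T -> 'I_N) :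
  rpc_pivots P A k s ->
  pivot_law A k (fun h => fine (P [set w | pivots s (size h) w = h])).
Proof.
move=> ps.
have ms i : (i < k)%N -> forall t, measurable [set w | s i w = t].
  by move=> /ps[].
have mh := pivots_measurable ms.
have splitE h t : [set w | pivots s (size (rcons h t)) w = rcons h t] =
    [set w | pivots s (size h) w = h] `&` [set w | s (size h) w = t].
  rewrite size_rcons; apply/seteqP; split=> w; rewrite /= /pivots mkseqS.
    by move=> /rcons_inj[].
  by move=> [-> ->].
split.
- rewrite (_ : [set w | _] = setT) ?probability_setT //.
  by apply/seteqP; split.
- by move=> h; apply: fine_ge0.
- move=> h hk.
  have -> : [set w | pivots s (size h) w = h] =
      \bigcup_(t in [set` predT]) [set w | pivots s (size (rcons h t)) w = rcons h t].
    apply/seteqP; split=> w /=.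
      move=> e; exists (s (size h) w) => //=.
      by rewrite size_rcons /pivots mkseqS -/(pivots _ _ _) e.
    by move=> [t _ /=]; rewrite size_rcons /pivots mkseqS => /rcons_inj[].
  rewrite measure_fin_bigcup; first last.
  + by move=> t _; apply: mh; rewrite size_rcons.
  + move=> t1 t2 _ _ [w [/=]]; rewrite !size_rcons => -> /rcons_inj[].
    by [].
  + exact: finite_finset.
  rewrite -(bigfs _ (r := index_enum _)) ?index_enum_uniq //; last first.
    by move=> t _; rewrite mem_index_enum.
  rewrite sum_fine // => t _; apply: fin_num_measure.
  by apply: mh; rewrite size_rcons.
- move=> h t hk /eqP nz; rewrite splitE.
  have [_ /(_ h t erefl nz) ->] := ps _ hk.
  rewrite fineM //.
  by apply: fin_num_measure; apply: mh; apply: ltnW.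
Qed.

Definition mean (R : realType) N (q : seq 'I_N -> R) (n : nat) (F : seq 'I_N -> R) : R :=
  \sum_(h : n.-tuple 'I_N) q h * F h.

Lemma mean_succ (R : realType) N (q : seq 'I_N -> R) n F :
  mean q n.+1 F = \sum_(h : n.-tuple 'I_N) \sum_t q (rcons h t) * F (rcons h t).
Proof.
pose f (p : n.-tuple 'I_N * 'I_N) : n.+1.-tuple 'I_N := [tuple of rcons p.1 p.2].
have fbij : bijective f.
  apply: inj_card_bij => [[h1 t1] [h2 t2] /(congr1 val) /= /rcons_inj[e ->]|].
    by congr (_, _); apply: val_inj.
  by rewrite card_prod !card_tuple card_ord expnSr.
by rewrite pair_big /= /mean (reindex f) //; apply: onW_bij.
Qed.

(** One step of a supermartingale.  The hypothesis is cleared of the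
    denominator of the pivot probabilities; a zero residual is treated apart, for
    then the next pivot is arbitrary. *)
Lemma mean_step_le (R : realType) N (A : 'M[R[i]]_N) k (q : seq 'I_N -> R) n F G :
  pivot_law A k q -> psdform A -> (n < k)%N ->
  (forall h, size h = n -> residual A h <> 0 ->
     \sum_t complex.Re (residual A h t t) * F (rcons h t) <= real_tr (residual A h) * G h) ->
  (forall h t, size h = n -> residual A h = 0 -> F (rcons h t) <= G h) ->
  mean q n.+1 F <= mean q n G.
Proof.
move=> [_ q0 qsum qstep] pA nk H1 H2; rewrite mean_succ; apply: ler_sum => h _.
have hn : size h = n := size_tuple h.
have [pM _] := psdform_residual h pA.
have [M0|/eqP M0] := eqVneq (residual A h) 0.
  rewrite -qsum ?hn // mulr_suml; apply: ler_sum => t _.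
  by apply: ler_wpM2l => //; apply: H2.
have tr0 := real_tr_gt0 pM M0.
apply: le_trans (_ : q h * ((real_tr (residual A h))^-1 *
    \sum_t complex.Re (residual A h t t) * F (rcons h t)) <= _).
  rewrite !mulr_sumr; apply: ler_sum => t _; rewrite qstep ?hn //.
  by rewrite le_eqVlt; apply/orP; left; apply/eqP; ring.
apply: ler_wpM2l => //; rewrite mulrC ler_pdivrMr // [_ * real_tr _]mulrC.
exact: H1.
Qed.

Lemma mean_take (R : realType) N (A : 'M[R[i]]_N) k (q : seq 'I_N -> R) m n F :
  pivot_law A k q -> (m + n <= k)%N ->
  mean q (m + n) (fun h => F (take m h)) = mean q m F.
Proof.
move=> law; elim: n => [|n IH] mnk.
  rewrite addn0; apply: eq_bigr => h _; by rewrite take_oversize ?size_tuple.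
rewrite addnS in mnk *; rewrite -[RHS](IH (ltnW mnk)) mean_succ; apply: eq_bigr => h _.
have [_ _ qsum _] := law.
have hk : (size h < k)%N by rewrite size_tuple.
rewrite -(qsum _ hk) mulr_suml; apply: eq_bigr => t _.
by rewrite -cats1 takel_cat // size_tuple leq_addr.
Qed.

Lemma mean0 (R : realType) N (q : seq 'I_N -> R) F : mean q 0 F = q [::] * F [::].
Proof.
rewrite /mean (big_pred1 [tuple]) // => h.
by apply/esym/eqP; exact: tuple0.
Qed.

Lemma meanZ (R : realType) N (q : seq 'I_N -> R) n c F :
  mean q n (fun h => c * F h) = c * mean q n F.
Proof. by rewrite /mean mulr_sumr; apply: eq_bigr => h _; rewrite mulrCA. Qed.

Lemma meanD (R : realType) N (q : seq 'I_N -> R) n F G :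
  mean q n (fun h => F h + G h) = mean q n F + mean q n G.
Proof. by rewrite /mean -big_split; apply: eq_bigr => h _; rewrite mulrDr. Qed.

Lemma mean_le (R : realType) N (q : seq 'I_N -> R) n F G : (forall h, 0 <= q h) ->
  (forall h, size h = n -> F h <= G h) -> mean q n F <= mean q n G.
Proof.
by move=> q0 FG; apply: ler_sum => h _; apply: ler_wpM2l => //; apply/FG/size_tuple.
Qed.

Lemma mean_cst (R : realType) N (A : 'M[R[i]]_N) k (q : seq 'I_N -> R) n c :
  pivot_law A k q -> (n <= k)%N -> mean q n (fun=> c) = c.
Proof.
move=> law nk; have := mean_take (m := 0) (n := n) (fun=> c) law nk.
by rewrite add0n mean0 => ->; have [-> _ _ _] := law; rewrite mul1r.
Qed.

(** * The trace falls to 4 d mu *)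

Lemma real_tr_residual_take (R : realType) N (A : 'M[R[i]]_N) h j : psdform A ->
  real_tr (residual A h) <= real_tr (residual A (take j h)).
Proof.
move=> pA; elim/last_ind: h => [|h t IH] //.
have [jh|hj] := leqP j (size h).
  rewrite -cats1 takel_cat // cats1; apply: le_trans IH; rewrite residual_rcons.
  by apply: real_tr_elim_le; have [] := psdform_residual h pA.
by rewrite take_oversize // size_rcons.
Qed.

Definition trace_prod (R : realType) N (A : 'M[R[i]]_N) (h : seq 'I_N) : R :=
  \prod_(0 <= j < size h) real_tr (residual A (take j h)).

Lemma trace_prod_rcons (R : realType) N (A : 'M[R[i]]_N) h t :
  trace_prod A (rcons h t) = trace_prod A h * real_tr (residual A h).
Proof.
rewrite /trace_prod size_rcons big_nat_recr //= -cats1 takel_cat // take_size.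
by congr (_ * _); apply: eq_big_nat => j /andP[_ jh]; rewrite takel_cat // ltnW.
Qed.

Lemma trace_prod_ge0 (R : realType) N (A : 'M[R[i]]_N) h : psdform A ->
  0 <= trace_prod A h.
Proof.
move=> pA; apply: prodr_ge0 => j _.
by apply: real_tr_ge0; have [] := psdform_residual (take j h) pA.
Qed.

(** The factor tr M_i gained at each step is the denominator of the pivot
    probabilities, so the bounds of [det_elim_sum] multiply. *)
Lemma mean_trace_prod_det (R : realType) N (A : 'M[R[i]]_N) (mu : R) k (q : seq 'I_N -> R) m :
  pivot_law A k q -> psdform A -> 0 < mu -> (m <= k)%N ->
  mean q m (fun h => trace_prod A h * ridge_det mu (residual A h)) <=
  (mu * deff A mu) ^+ m * ridge_det mu A.
Proof.
move=> law pA mu0; elim: m => [|m IH] mk.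
  rewrite mean0 /trace_prod big_geq // residual_nil expr0.
  by have [-> _ _ _] := law; rewrite !mul1r.
have d0 : 0 <= mu * deff A mu.
  by rewrite mulr_ge0 ?(ltW mu0) // -ler0c deffE // effdim_ge0 // real_complex_gt0.
have rd0 h : 0 <= ridge_det mu (residual A h).
  have [pM _] := psdform_residual h pA.
  rewrite ridge_det_prod //; apply: prodr_ge0 => i _.
  by rewrite addr_ge0 ?eigval_ge0 // ltW.
rewrite exprS -mulrA; apply: le_trans (ler_wpM2l d0 (IH (ltnW mk))).
rewrite -meanZ; apply: (mean_step_le law pA mk) => [h _ _|h t _ M0].
  have [pM pAM] := psdform_residual h pA.
  have := ridge_det_elim_sum mu0 pM pAM.
  have tp0 : 0 <= trace_prod A h * real_tr (residual A h).
    by rewrite mulr_ge0 ?trace_prod_ge0 ?real_tr_ge0.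
  move=> /(ler_wpM2l tp0); rewrite mulr_sumr => le.
  apply: le_trans (le_trans le _).
    apply: ler_sum => t _; rewrite trace_prod_rcons residual_rcons.
    by rewrite le_eqVlt; apply/orP; left; apply/eqP; ring.
  by rewrite le_eqVlt; apply/orP; left; apply/eqP; ring.
rewrite trace_prod_rcons M0 /real_tr mxtrace0 /= mulr0 mul0r -M0.
by rewrite mulr_ge0 // mulr_ge0 // trace_prod_ge0.
Qed.

(** By induction on J: some eigenvalue in J is at most the last of the traces; the
    others are bounded by the remaining traces.  This replaces an ordering of the
    eigenvalues. *)
Lemma prod_eigval_le_traces (R : realType) N (A : 'M[R[i]]_N) h (J : {set 'I_N}) :
  psdform A -> (#|J| <= size h)%N ->
  \prod_(j in J) eigval A j <= \prod_(0 <= j < #|J|) real_tr (residual A (take j h)).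
Proof.
move=> pA; move rE : #|J| => r.
elim: r J rE => [|r IH] J rE rh.
  by rewrite big_geq // big1 // => j; rewrite (cards0_eq rE) inE.
have [|j jJ le] := @eigval_le_residual R N A J (take r h) pA.
  by rewrite size_takel ?rE // ltnW.
rewrite (big_setD1 j) //= big_nat_recr //= mulrC; apply: ler_pM => //.
- by apply: prodr_ge0 => i _; apply: eigval_ge0.
- exact: eigval_ge0.
- by apply: IH; [rewrite (cardsD1 j) jJ in rE; case: rE | exact: ltnW].
Qed.

Lemma trace_prod_ge (R : realType) N (A : 'M[R[i]]_N) h (J : {set 'I_N}) (tau : R) :
  psdform A -> (#|J| <= size h)%N -> 0 <= tau -> tau <= real_tr (residual A h) ->
  (\prod_(j in J) eigval A j) * tau ^+ (size h - #|J|) <= trace_prod A h.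
Proof.
move=> pA Jh tau0 le.
rewrite /trace_prod (big_cat_nat (n := #|J|)) //=; apply: ler_pM => //.
- by apply: prodr_ge0 => i _; apply: eigval_ge0.
- exact: exprn_ge0.
- exact: prod_eigval_le_traces.
rewrite -prodr_const_nat; apply: ler_prod => j _; rewrite tau0 /=.
exact/(le_trans le)/real_tr_residual_take.
Qed.

(** Traces decrease along the steps, so if the last one exceeds tau all of them
    do.  Those before step #|J| are bounded below by the eigenvalues in J instead. *)
Lemma mean_large_trace (R : realType) N (A : 'M[R[i]]_N) (mu tau : R) k (q : seq 'I_N -> R) m
    (J : {set 'I_N}) :
  pivot_law A k q -> psdform A -> 0 < mu -> (m <= k)%N -> 0 < tau -> (#|J| <= m)%N ->
  mean q m (fun h => (tau < real_tr (residual A h))%R%:R) *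
    (tau ^+ m * \prod_j (if j \in J then eigval A j * mu / tau else mu)) <=
  (mu * deff A mu) ^+ m * \prod_j (eigval A j + mu).
Proof.
move=> law pA mu0 mk tau0 Jm.
have [_ q0 _ _] := law.
(* The weights mu / tau inside J make the power of tau the same for all J. *)
have wE : tau ^+ m * \prod_j (if j \in J then eigval A j * mu / tau else mu) =
    (\prod_(j in J) eigval A j) * tau ^+ (m - #|J|) * \prod_(j < N) mu.
  have e1 : (\prod_j (if j \in J then eigval A j * mu / tau else mu)) * tau ^+ #|J| =
      (\prod_(j in J) eigval A j) * \prod_(j < N) mu.
    have -> : tau ^+ #|J| = \prod_j (if j \in J then tau else 1).
      by rewrite -prodr_const big_mkcond.
    rewrite [\prod_(j in J) eigval A j]big_mkcond -!big_split; apply: eq_bigr => j _ /=.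
    case: ifP => _; last by rewrite mulr1 mul1r.
    by rewrite divfK // gt_eqF.
  have -> : tau ^+ m = tau ^+ (m - #|J|) * tau ^+ #|J| by rewrite -exprD subnK.
  by rewrite -mulrA [tau ^+ #|J| * _]mulrC e1; ring.
rewrite wE -(ridge_det_prod mu0 pA) mulrC -meanZ.
apply: le_trans (mean_trace_prod_det law pA mu0 mk).
apply: mean_le => // h hm; have [pM _] := psdform_residual h pA.
have tp0 := trace_prod_ge0 h pA.
rewrite ridge_det_prod //.
have pr : 0 <= \prod_(j < N) mu <= \prod_i (eigval (residual A h) i + mu).
  apply/andP; split; first by apply: prodr_ge0 => i _; apply: ltW.
  by apply: ler_prod => i _; rewrite (ltW mu0) /= lerDr eigval_ge0.
have [pr0 pr1] := andP pr.
case: ltP => [lt|_]; last by rewrite mulr0 mulr_ge0 // (le_trans pr0).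
rewrite mulr1; apply: ler_pM => //.
  by rewrite mulr_ge0 ?exprn_ge0 ?(ltW tau0) // prodr_ge0 // => i _; apply: eigval_ge0.
by rewrite -hm; apply: trace_prod_ge; rewrite ?hm // ltW.
Qed.

Lemma expR1_le4 (R : realType) : expR 1 <= 4 :> R.
Proof.
have h1 : 0 < expR (2^-1 : R) by exact: expR_gt0.
have h2 := expR_ge1Dx (- 2^-1 : R); rewrite expRN in h2.
have h3 : expR (2^-1 : R) * (expR (2^-1 : R))^-1 = 1 by rewrite mulfV // gt_eqF.
have h4 : expR (2^-1 : R) <= 2 by nra.
have -> : expR 1 = expR (2^-1) * expR (2^-1) :> R by rewrite -expRD; congr expR; lra.
nra.
Qed.

(** J gathers the eigenvalues that are at least mu; there are at most 2 d of them.
    After the cancellation, each eigenvalue x leaves a factor at most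
    exp (2 ln (8 d) x / (x + mu)), and these exponents add up to 2 d ln (8 d). *)
Lemma prob_large_trace (R : realType) N (A : 'M[R[i]]_N) (mu : R) k (q : seq 'I_N -> R) m :
  pivot_law A k q -> psdform A -> 0 < mu -> (m <= k)%N ->
  2^-1 < deff A mu -> 2 * deff A mu <= m%:R ->
  mean q m (fun h => (4 * deff A mu * mu < real_tr (residual A h))%R%:R) <=
  expR (2 * deff A mu * ln (8 * deff A mu) - m%:R).
Proof.
move=> law pA mu0 mk; set d := deff A mu => dhalf dm.
set tau := 4 * d * mu; have tau0 : 0 < tau by rewrite /tau; nra.
pose J : {set 'I_N} := finset (fun j => mu <= eigval A j).
pose lev j := eigval A j / (eigval A j + mu).
have lam0 j : 0 <= eigval A j := eigval_ge0 j pA.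
have lm0 j : 0 < eigval A j + mu by rewrite ltr_wpDl.
have lev0 j : 0 <= lev j by rewrite divr_ge0 // ltW.
have dE : d = \sum_j lev j by rewrite /d deff_sum.
have levJ j : j \in J -> 1 <= 2 * lev j.
  by rewrite inE => h; rewrite mulrA ler_pdivlMr //; lra.
have Jm : (#|J| <= m)%N.
  rewrite -(ler_nat R); apply: le_trans dm; rewrite dE mulr_sumr -sum1_card natr_sum.
  rewrite [leRHS](bigID (mem J)) /= ler_wpDr //; last by apply: ler_sum.
  by apply: sumr_ge0 => j _; rewrite mulr_ge0.
have := mean_large_trace law pA mu0 mk tau0 Jm; rewrite -/d.
set X := mean _ _ _; set w := \prod_j _.
have w0 : 0 < w.
  apply: prodr_gt0 => j _; case: ifP => [|_]; last exact: mu0.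
  by rewrite inE => h; rewrite divr_gt0 // mulr_gt0 // (lt_le_trans mu0).
set l := ln (8 * d).
have el : expR l = 8 * d by rewrite lnK // posrE; lra.
have l1 : 1 <= l.
  by rewrite -ler_expR el; have := expR1_le4 R; lra.
have detle : \prod_j (eigval A j + mu) <= expR (2 * d * l) * w.
  have -> : expR (2 * d * l) = \prod_j expR (2 * lev j * l).
    rewrite -(big_morph expR (@expRD R) (@expR0 R)).
    by rewrite -mulr_suml -mulr_sumr -dE.
  rewrite -big_split; apply: ler_prod => j _; rewrite (ltW (lm0 j)) /=.
  case: ifP => [jJ|].
    have e8 : 8 * d <= expR (2 * lev j * l).
      by rewrite -el ler_expR; have := levJ j jJ; nra.
    have -> : eigval A j * mu / tau = eigval A j / (4 * d).
      by rewrite /tau; field; apply/andP; split; apply/eqP; lra.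
    move: jJ; rewrite inE => jJ; rewrite mulrA ler_pdivlMr; last lra.
    have := lam0 j; nra.
  rewrite inE => /negbT; rewrite -ltNge => lt.
  apply: le_trans (_ : expR (eigval A j / mu) * mu <= _).
    have := expR_ge1Dx (eigval A j / mu) => /(ler_wpM2r (ltW mu0)).
    by rewrite mulrDl mul1r divfK ?gt_eqF // addrC.
  rewrite ler_wpM2r ?(ltW mu0) // ler_expR; apply: le_trans (_ : 2 * lev j <= _).
    rewrite mulrA ler_pdivrMr // mulrAC ler_pdivlMr //; have := lam0 j; nra.
  by rewrite ler_peMr // mulr_ge0.
have X0 : 0 <= X.
  by apply: sumr_ge0 => h _; have [_ q0 _ _] := law; rewrite mulr_ge0.
move=> le1.
have le2 : X * (tau ^+ m * w) <= (mu * d) ^+ m * (expR (2 * d * l) * w).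
  by apply: le_trans le1 _; rewrite ler_wpM2l // exprn_ge0 // mulr_ge0 ?ltW //; lra.
(* This is where the constant 4 of the threshold enters: exp 1 <= 4. *)
have le3 : (mu * d) ^+ m <= expR (- m%:R) * tau ^+ m.
  have -> : - m%:R = m%:R * (-1) :> R by rewrite mulrN1.
  rewrite expRM_natl -exprMn; apply: lerXn2r; rewrite ?nnegrE.
  - by rewrite mulr_ge0 ?ltW //; lra.
  - by rewrite mulr_ge0 ?expR_ge0 ?ltW.
  have e4 := expR1_le4 R; rewrite expRN /tau -ler_pdivrMl ?invr_gt0 ?expR_gt0 // invrK.
  have md0 : 0 <= mu * d by rewrite mulr_ge0 ?ltW //; lra.
  by have := ler_wpM2r md0 e4; lra.
have tw0 : 0 < tau ^+ m * w by rewrite mulr_gt0 // exprn_gt0.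
rewrite -(ler_pM2r tw0); apply: (le_trans le2).
have ew : 0 <= expR (2 * d * l) * w by rewrite mulr_ge0 ?expR_ge0 ?ltW.
apply: le_trans (ler_wpM2r ew le3) _.
by rewrite expRD le_eqVlt; apply/orP; left; apply/eqP; ring.
Qed.

(** * The largest eigenvalue falls to mu *)

(** The factor before the potential discards the runs whose trace is still large
    at time m; on the others the trace stays below tau. *)
Lemma mean_excess (R : realType) N (A : 'M[R[i]]_N) (theta tau : R) k
    (q : seq 'I_N -> R) m n :
  pivot_law A k q -> psdform A -> 0 < theta -> theta <= tau -> (m + n <= k)%N ->
  mean q (m + n) (fun h => (real_tr (residual A (take m h)) <= tau)%R%:R *
     excess_mass theta (residual A h)) <= (1 - theta / tau) ^+ n * tau.
Proof.
move=> law pA th0 thtau; have [_ q0 _ _] := law.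
have tau0 : 0 < tau by lra.
have r0 : 0 <= 1 - theta / tau by rewrite subr_ge0 ler_pdivrMr // mul1r.
have exc h : 0 <= excess_mass theta (residual A h) <= real_tr (residual A h).
  by have [pM _] := psdform_residual h pA; exact: excess_mass_le.
elim: n => [|n IH] mnk.
  rewrite addn0 in mnk *; rewrite expr0 mul1r -[leRHS](mean_cst tau law mnk).
  apply: mean_le => // h hm; rewrite take_oversize ?hm //.
  have /andP[e0 e1] := exc h.
  case: (leP (real_tr (residual A h)) tau) => c; first by rewrite mul1r; exact: le_trans c.
  by rewrite mul0r; exact: ltW.
rewrite addnS in mnk *; rewrite exprS -mulrA.
apply: le_trans (ler_wpM2l r0 (IH (ltnW mnk))); rewrite -meanZ.
apply: (mean_step_le law pA mnk) => [h hm _|h t hm M0].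
  have [pM _] := psdform_residual h pA.
  have /andP[e0 e1] := exc h.
  have tk t : take m (rcons h t) = take m h.
    by rewrite -cats1 takel_cat // hm leq_addr.
  case: (leP (real_tr (residual A (take m h))) tau) => c; last first.
    rewrite mul0r !mulr0 big1 // => t _.
    by rewrite tk leNgt c mul0r mulr0.
  under eq_bigr do rewrite tk c mul1r residual_rcons.
  apply: le_trans (excess_mass_elim_sum th0 pM) _; rewrite mul1r mulrA ler_wpM2r //.
  have := real_tr_residual_take h m pA => mt.
  rewrite mulrBr mulr1 lerD2l lerN2 mulrA ler_pdivrMr // mulrC ler_wpM2l ?(ltW th0) //.
  exact: le_trans mt c.
rewrite -cats1 takel_cat ?hm ?leq_addr // cats1 residual_rcons M0.
rewrite (_ : elim 0 t = 0); last by rewrite /elim mxE invr0 scale0r subr0.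
have e0 : excess_mass theta (0 : 'M[R[i]]_N) = 0.
  have := exc h; rewrite M0 /real_tr mxtrace0 /= => /andP[a b].
  by apply/eqP; rewrite eq_le a b.
by rewrite e0 !mulr0.
Qed.

(** No eigenvalue x of A exceeds mu, as x / (x + mu) <= d <= 1/2. *)
Lemma psdform_residual_small (R : realType) N (A : 'M[R[i]]_N) (mu : R) h :
  psdform A -> 0 < mu -> deff A mu <= 2^-1 -> psdform ((mu%:C)%:M - residual A h).
Proof.
move=> pA mu0 dsmall; have [pM pAM] := psdform_residual h pA.
have lam0 j : 0 <= eigval A j := eigval_ge0 j pA.
have lm0 j : 0 < eigval A j + mu by rewrite ltr_wpDl.
have pmA : psdform ((mu%:C)%:M - A).
  apply: eigval_le_psdform => // j.
  have : eigval A j / (eigval A j + mu) <= 2^-1.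
    apply: le_trans dsmall; rewrite deff_sum // (bigD1 j) //= lerDl.
    by apply: sumr_ge0 => l _; rewrite divr_ge0 // ltW.
  by rewrite ler_pdivrMr //; lra.
exact: psdform_sub_trans pmA pAM.
Qed.

(** Each of the two stages fails with probability at most delta / 2. *)
Lemma prob_large_residual (R : realType) N (A : 'M[R[i]]_N) (mu delta : R) k
    (q : seq 'I_N -> R) :
  pivot_law A k q -> psdform A -> 0 < mu -> 0 < delta < 1 -> 2^-1 < deff A mu ->
  30 * deff A mu * ln (16 * deff A mu / delta) <= k%:R ->
  mean q k (fun h => (~~ `[< psdform ((mu%:C)%:M - residual A h) >])%:R) <= delta.
Proof.
move=> law pA mu0 /andP[de0 de1]; set d := deff A mu => dhalf; set L := ln _ => kL.
have [_ q0 _ _] := law.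
have arg0 : 0 < 16 * d / delta by rewrite divr_gt0 //; lra.
have arg8 : 8 * d <= 16 * d / delta by rewrite ler_pdivlMr //; nra.
have lL : ln (8 * d) <= L by rewrite ler_ln ?posrE //; lra.
have L1 : 1 <= L.
  rewrite -ler_expR /L lnK ?posrE //; apply: le_trans arg8.
  by have := expR1_le4 R; lra.
have dL : 2^-1 <= d * L by nra.
(* 4 d L steps suffice for the first stage: 2 d ln (8 d) and L are at most 2 d L. *)
set m := (Num.trunc (4 * d * L)).+1.
have m1 : 4 * d * L < m%:R by exact: truncnS_gt.
have m2 : m%:R <= 4 * d * L + 1.
  by rewrite /m -addn1 natrD lerD2r truncn_le; nra.
have mk : (m <= k)%N by rewrite -(ler_nat R); apply: le_trans kL; lra.
have [n kE] : exists n, k = (m + n)%N by exists (k - m)%N; rewrite subnKC.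
have n8 : 8 * d * L <= n%:R.
  by move: kL; rewrite kE natrD; lra.
set tau := 4 * d * mu.
have eL : expR (- L) = delta / (16 * d).
  by rewrite expRN /L lnK ?posrE // invf_div.
have p1 : mean q k (fun h => (tau < real_tr (residual A (take m h)))%R%:R) <= delta / 2.
  rewrite kE (mean_take (fun h => (tau < real_tr (residual A h))%R%:R) law) -?kE //.
  apply: le_trans (prob_large_trace law pA mu0 mk dhalf _) _; first by rewrite -/d; nra.
  apply: le_trans (_ : expR (- L) <= _).
    by rewrite ler_expR -/d; nra.
  rewrite eL ler_pdivrMr; last lra.
  by nra.
have th0 : 0 < mu / 2 by lra.
have tht : mu / 2 <= tau by rewrite /tau; nra.
have p2 : mean q k (fun h => (real_tr (residual A (take m h)) <= tau)%R%:R *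
     excess_mass (mu / 2) (residual A h)) <= mu / 2 * (delta / 2).
  rewrite kE; apply: le_trans (mean_excess law pA th0 tht _) _; first by rewrite -kE.
  have -> : 1 - mu / 2 / tau = 1 + - (8 * d)^-1.
    by rewrite /tau; field; apply/andP; split; apply/eqP; lra.
  have r0 : 0 <= 1 + - (8 * d)^-1.
    by rewrite subr_ge0 invf_le1; lra.
  apply: le_trans (_ : expR (- L) * tau <= _).
    rewrite ler_wpM2r //; first by lra.
    apply: le_trans (_ : expR (- (8 * d)^-1) ^+ n <= _).
      by apply: lerXn2r; rewrite ?nnegrE ?expR_ge0 // expR_ge1Dx.
    rewrite -expRM_natl ler_expR mulrN lerN2 ler_pdivlMr; last lra.
    by rewrite mulrC.
  by rewrite eL /tau le_eqVlt; apply/orP; left; apply/eqP; field; apply/eqP; lra.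
have c0 : 0 <= (mu / 2)^-1 by rewrite invr_ge0 ltW.
apply: le_trans (_ : mean q k (fun h => (tau < real_tr (residual A (take m h)))%R%:R +
   (mu / 2)^-1 * ((real_tr (residual A (take m h)) <= tau)%R%:R *
     excess_mass (mu / 2) (residual A h))) <= _); last first.
  rewrite meanD meanZ; apply: le_trans (lerD p1 (ler_wpM2l c0 p2)) _.
  by rewrite mulKf ?gt_eqF // -splitr.
apply: mean_le => // h _.
have [pM _] := psdform_residual h pA.
have /andP[e0 _] := excess_mass_le th0 pM.
case: (leP (real_tr (residual A (take m h))) tau) => c.
  rewrite add0r mul1r; case: asboolP => [|np] /=.
    by rewrite mulr_ge0.
  have le : mu / 2 <= excess_mass (mu / 2) (residual A h).
    rewrite leNgt; apply/negP => small; apply: np.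
    by apply: (excess_mass_small th0 pM); lra.
  by clear -le th0; rewrite ler_pdivlMl // mulr1.
by rewrite mul0r mulr0 addr0 lern1 leq_b1.
Qed.

(** * The condition number *)

Theorem corollary1p5 (R : realType) (N : nat) (A : 'M[R[i]]_N) (mu delta : R)
    (k : nat) (d : measure_display) (T : measurableType d)
    (P : probability T R) (s : nat -> T -> 'I_N) :
  psdmx A ->
  0 < mu ->
  0 < delta < 1 ->
  30 * deff A mu * ln (16 * deff A mu / delta) <= k%:R ->
  rpc_pivots P A k s ->
  ((1 - delta)%:E <=
   P [set w |
      let B := invsqrtmx (rpc_approx A (pivots s k w) + (mu%:C)%:M) in
      (cond (B *m (A + (mu%:C)%:M) *m B) <= 2)%R])%E.
Proof.
move=> /psdmx_psdform pA mu0 hdelta hk ps.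
have law := rpc_pivots_law ps; set q := (fun h => fine _) in law.
have [_ q0 _ _] := law.
pose good h := `[< psdform ((mu%:C)%:M - residual A h) >].
have bad_le : mean q k (fun h => (~~ good h)%:R) <= delta.
  have [dsmall|dbig] := leP (deff A mu) 2^-1.
    rewrite /mean big1; first by case/andP: hdelta => /ltW.
    move=> h _; have : good h by apply/asboolP; exact: psdform_residual_small.
    by move=> ->; rewrite mulr0.
  exact: prob_large_residual.
pose Q h := cond (invsqrtmx (rpc_approx A h + (mu%:C)%:M) *m (A + (mu%:C)%:M) *m
        invsqrtmx (rpc_approx A h + (mu%:C)%:M)) <= 2.
have goodQ h : good h -> Q h by move=> /asboolP; apply: cond_residual_le2.
rewrite -[[set w | _]]/[set w | Q (pivots s k w)].
have ms i : (i < k)%N -> forall t, measurable [set w | s i w = t] by move=> /ps[].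
have [_ ->] := pivots_prob_sum P Q ms (leqnn k).
rewrite lee_fin -(mean_cst 1 law (leqnn k)) lerBlDr.
apply: le_trans (_ : \sum_(h : k.-tuple 'I_N | Q h) fine (P [set w | pivots s k w = h]) +
   mean q k (fun h => (~~ good h)%:R) <= _); last by rewrite lerD2l.
rewrite big_mkcond /= /mean -big_split; apply: ler_sum => h _ /=.
have -> : fine (P [set w | pivots s k w = h]) = q h by rewrite /q size_tuple.
have := q0 h; rewrite mulr1; case gh: (good h) => /=.
  by rewrite (goodQ h gh) mulr0 addr0.
by case: ifP; rewrite mulr1 ?lerDl ?add0r.
Qed.
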